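(* Let $G^{\varphi}$ be a connected complex unit gain graph with underlying graph $G$. Then $n(G^{\varphi})=m(G)-c(G)$ if and only if the following three conditions all hold: (a) any two (distinct) cycles of $G^{\varphi}$ share no common vertices; (b) each cycle of $G^{\varphi}$ is of Type A; (c) $m(T_{G})=m(G-O(G))$.
   Context: All graphs are finite and simple (no loops or multiple edges). A complex unit gain graph $G^{\varphi}$ consists of a graph $G$ (the underlying graph) with vertices $v_1,\dots,v_n$ and a function $\varphi$ assigning to each oriented edge $e_{ij}$ (from $v_i$ to $v_j$, where $v_iv_j\in E(G)$; both orientations of each edge are considered) a number $\varphi(e_{ij})=\varphi_{v_iv_j}\in\mathbb{T}=\{z\in\mathbb{C}:|z|=1\}$ such that $\varphi(e_{ij})=\varphi(e_{ji})^{-1}=\overline{\varphi(e_{ji})}$. Its adjacency matrix $A(G^{\varphi})$ is the $n\times n$ Hermitian matrix with $(i,j)$ entry $\varphi(e_{ij})$ if $v_iv_j\in E(G)$ and $0$ otherwise. $n(G^{\varphi})$ denotes the number of negative eigenvalues of $A(G^{\varphi})$, counted with multiplicity. $m(G)$ is the matching number of $G$ (with $m=0$ for a graph without vertices). $c(G)=|E(G)|-|V(G)|+\omega(G)$ is the cyclomatic number, where $\omega(G)$ is the number of connected components of $G$. Cycles of $G^{\varphi}$ are the cycles of $G$ with the restricted gains; $G^{\varphi}$ is connected if $G$ is. For a cycle $C_q$ with consecutive vertices $w_1,w_2,\dots,w_q$, $q\ge 3$, put $\varphi(C_q)=\varphi_{w_1w_2}\varphi_{w_2w_3}\cdots\varphi_{w_{q-1}w_q}\varphi_{w_qw_1}$.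 The cycle is of Type A if $q$ is even and $\varphi(C_q)=(-1)^{q/2}$ (this does not depend on the starting vertex or direction). $O(G)$ is the set of vertices lying on cycles of $G$, and $G-O(G)$ is the induced subgraph obtained by deleting these vertices. When the cycles of $G$ are pairwise vertex-disjoint, $T_G$ is the acyclic graph obtained from $G$ by contracting each cycle of $G$ to a single vertex (so $T_G=G$ if $G$ has no cycles); condition (c) is understood together with condition (a), under which $T_G$ is defined. *)

(* Defs.v *)
From HB Require Import structures.
From mathcomp Require Import all_boot all_order all_algebra.
From mathcomp Require Import reals complex.

Set Implicit Arguments.
Unset Strict Implicit.
Unset Printing Implicit Defensive.

Import Order.TTheory GRing.Theory Num.Theory.
Local Open Scope ring_scope.

Record sgraph := SGraph {
  svertex :> finType;
  sedge : rel svertex;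
  sedge_sym : symmetric sedge;
  sedge_irrefl : irreflexive sedge }.

Definition edges (G : sgraph) : {set {set G}} :=
  [set E | [exists x : G, exists y : G, sedge x y && (E == [set x; y])]].

(* No nonemptiness is required, so the null graph counts as connected. *)
Definition connected_graph (G : sgraph) : Prop :=
  forall x y : G, connect (@sedge G) x y.

Definition num_components (G : sgraph) : nat := n_comp (@sedge G) G.

Definition cyclomatic (G : sgraph) : int :=
  #|edges G|%:Z - #|G|%:Z + (num_components G)%:Z.

Definition matching (G : sgraph) (M : {set {set G}}) : bool :=
  (M \subset edges G) && trivIset M.

Definition matching_number (G : sgraph) : nat :=
  (\max_(M : {set {set G}} | matching M) #|M|)%N.

Section Induced.
Variables (G : sgraph) (S : {set G}).

Definition induced_edge : rel {x : G | x \in S} :=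
  fun x y => sedge (val x) (val y).

Lemma induced_sym : symmetric induced_edge.
Proof. by move=> x y; exact: sedge_sym. Qed.

Lemma induced_irrefl : irreflexive induced_edge.
Proof. by move=> x; exact: sedge_irrefl. Qed.

Definition induced : sgraph := SGraph induced_sym induced_irrefl.
End Induced.

(* A cycle is given by its vertices listed consecutively; two lists describe   *)
(* the same cycle (as a subgraph) exactly when they have the same edge set.    *)
Definition is_cycle (G : sgraph) (c : seq G) : bool :=
  [&& (2 < size c)%N, uniq c & cycle (@sedge G) c].

Definition cycle_edges (G : sgraph) (c : seq G) : {set {set G}} :=
  [set [set x; next c x] | x in c].

Definition cycles_disjoint (G : sgraph) : Prop :=
  forall c1 c2 : seq G, is_cycle c1 -> is_cycle c2 ->
    cycle_edges c1 <> cycle_edges c2 -> [disjoint c1 & c2].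

Definition cycle_vsets (G : sgraph) : {set {set G}} :=
  [set B : {set G} | [exists c : #|B|.-tuple G,
                        is_cycle c && ([set x in c] == B)]].

Lemma cycle_vsetsP (G : sgraph) (B : {set G}) :
  reflect (exists2 c : seq G, is_cycle c & [set x in c] = B)
          (B \in cycle_vsets G).
Proof.
rewrite inE; apply: (iffP existsP) => [[c /andP[cc /eqP eB]]|[c cc eB]].
  by exists c.
have sc : size c == #|B|.
  by case/and3P: (cc) => _ uc _; rewrite -eB cardsE (card_uniqP uc).
by exists (Tuple sc); rewrite cc /=; apply/eqP.
Qed.

Definition cycle_vertices (G : sgraph) : {set G} := cover (cycle_vsets G).

Lemma cycle_verticesP (G : sgraph) (x : G) :
  reflect (exists2 c : seq G, is_cycle c & x \in c) (x \in cycle_vertices G).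
Proof.
apply: (iffP bigcupP) => [[B /cycle_vsetsP[c cc <-]]|[c cc xc]].
  by rewrite inE => xc; exists c.
by exists [set y in c]; [apply/cycle_vsetsP; exists c | rewrite inE].
Qed.

(* T_G.  Its vertices are the vertex sets of the cycles and the singletons of  *)
(* the vertices lying on no cycle.  This is the contraction of the cycles only *)
(* when cycles_disjoint G holds; the blocks then partition the vertices, and   *)
(* contraction creates neither loops nor parallel edges.  Otherwise the blocks *)
(* may overlap and the value has no meaning.                                   *)
Section Contraction.
Variable G : sgraph.

Definition contract_blocks : {set {set G}} :=
  cycle_vsets G :|: [set [set x] | x in ~: cycle_vertices G].

Definition contract_edge : rel {B : {set G} | B \in contract_blocks} :=
  fun B1 B2 => (B1 != B2) &&
    [exists x in val B1, exists y in val B2, sedge x y].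

Lemma contract_sym : symmetric contract_edge.
Proof.
suff H B1 B2 : contract_edge B1 B2 -> contract_edge B2 B1.
  by move=> B1 B2; apply/idP/idP; exact: H.
case/andP=> neB /existsP[x /andP[xB /existsP[y /andP[yB xy]]]].
rewrite /contract_edge eq_sym neB; apply/existsP; exists y; rewrite yB /=.
by apply/existsP; exists x; rewrite xB sedge_sym.
Qed.

Lemma contract_irrefl : irreflexive contract_edge.
Proof. by move=> B; rewrite /contract_edge eqxx. Qed.

Definition contract_cycles : sgraph := SGraph contract_sym contract_irrefl.
End Contraction.

(* The values of gain outside the edges are irrelevant. *)
Record unit_gain (C : numClosedFieldType) (G : sgraph) := UnitGain {
  gain :> G -> G -> C;
  gain_norm : forall x y : G, sedge x y -> `|gain x y| = 1;
  gain_inv : forall x y : G, sedge x y -> gain x y = (gain y x)^-1 }.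

Definition cycle_gain (C : numClosedFieldType) (G : sgraph)
    (phi : unit_gain C G) (c : seq G) : C :=
  \prod_(x <- c) phi x (next c x).

Definition type_A (C : numClosedFieldType) (G : sgraph)
    (phi : unit_gain C G) (c : seq G) : Prop :=
  ~~ odd (size c) /\ cycle_gain phi c = (-1) ^+ (size c)./2.

Definition adjacency (C : numClosedFieldType) (G : sgraph)
    (phi : unit_gain C G) : 'M[C]_#|G| :=
  \matrix_(i, j) if sedge (enum_val i) (enum_val j)
                 then phi (enum_val i) (enum_val j) else 0.

(* The roots of the characteristic polynomial, listed with multiplicity. *)
Definition eigenvalues (C : numClosedFieldType) n (A : 'M[C]_n) : seq C :=
  sval (closed_field_poly_normal (char_poly A)).

(* In a numClosedFieldType, z < 0 entails that z is real. *)
Definition negative_inertia (C : numClosedFieldType) (G : sgraph)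
    (phi : unit_gain C G) : nat :=
  count (fun z => z < 0) (eigenvalues (adjacency phi)).

(* Main.v *)
Require Import Defs.
From mathcomp Require Import all_boot all_order all_algebra.
From mathcomp Require Import reals complex.
From mathcomp Require Import zify ring.

Set Implicit Arguments.
Unset Strict Implicit.
Unset Printing Implicit Defensive.

Import Order.TTheory GRing.Theory Num.Theory.

(** The idea is to trade eigenvalues for subspaces.  A family spanning a negative
   definite space bounds the number of negative eigenvalues from below
   ([negative_definite_leq]), an independent totally isotropic family bounds it
   from above ([totally_isotropic_leq]), so no spectrum has to be computed.
   Write n, m, c for n(G), m(G), c(G), and O for the set of vertices on cycles.
   A matching is handled as an involution [mu] on the set [S] of its vertices,
   so that the matching has half as many edges as [S] has vertices.

   Lower bound.  If no cycle inside [S] is matched within itself, alternating paths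
   find a vertex whose only neighbour in [S] is its mate ([alternating_path]).
   Such a pair spans a hyperbolic plane that can be split off, so [S] carries a
   negative definite space of dimension |S|/2 ([negative_half_open]).  Deleting
   cycle edges one at a time down to a tree, and collecting an end of each, gives
   at most c vertices that meet every cycle; removing them from a maximum matching
   yields n >= m - c ([inertia_lower]).

   Equality forces the conditions, because any saved vertex would give
   n > m - c ([extremal_avoiding]).  If two different cycles met, one vertex could
   serve for two deleted edges.  With disjoint cycles, c - 1 vertices destroy all
   cycles but a given one; hence every maximum matching is perfect on that cycle,
   which is therefore even, and a cycle not of Type A would itself carry a negative
   definite space of half its length ([negative_half_non_type_A]).  It follows that
   m <= m(G-O) + |O|/2.  A maximum matching of T_G meets each cycle in at most one
   vertex and extends inside the even cycles to a matched set without cycles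
   ([lift_matching]); the lower bound, and the fact that c is the number of cycles,
   give m >= m(T_G) + |O|/2.  Together with m(G-O) <= m(T_G) this is (c).

   Conversely, T_G is a forest ([contract_acyclic]), so by König's theorem it has a
   vertex cover with m(T_G) elements.  As m(T_G) = m(G-O), the cover uses no cycle
   ([konig_cover_off_cycles]): outside some m(T_G) vertices off the cycles, only
   disjoint cycles and isolated vertices remain.  Their isolated vertices, the
   even positions of the cycles and, by Type A, one null vector per cycle on its
   odd positions form an isotropic family ([inertia_upper]), which gives
   n <= m(T_G) + |O|/2 - c <= m - c. *)

(** * Cycles, bridges and edge deletion *)

Section CycleBasics.
Variable G : sgraph.
Implicit Types (x y u v : G) (c : seq G).

Lemma is_cycle_uniq c : is_cycle c -> uniq c.
Proof. by case/and3P. Qed.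

Lemma is_cycle_next c x : is_cycle c -> x \in c -> sedge x (next c x).
Proof. by case/and3P=> _ _ cc; apply: next_cycle. Qed.

Lemma is_cycle_rot n c : is_cycle (rot n c) = is_cycle c.
Proof. by rewrite /is_cycle size_rot rot_uniq rot_cycle. Qed.

Lemma is_cycle_rot_to c x : is_cycle c -> x \in c ->
  exists i s, [/\ rot i c = [:: x, next c x & s], s != [::],
                 is_cycle [:: x, next c x & s] & next [:: x, next c x & s] =1 next c].
Proof.
move=> cc xc; have uc := is_cycle_uniq cc.
case: (rot_to xc) => i s Dc; have := cc; rewrite -(is_cycle_rot i) Dc.
case: s Dc => [|y s] Dc cc'; first by [].
have nE : next c x = y by rewrite -(next_rot i uc) Dc /= eqxx.
exists i, s; rewrite nE; split => //; first by case: (s) cc'.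
by move=> z; rewrite -Dc next_rot.
Qed.

Lemma is_cycle_next_neq c x : is_cycle c -> x \in c -> next c x != x.
Proof.
move=> cc xc; apply/negP => /eqP nx; have := is_cycle_next cc xc.
by rewrite nx sedge_irrefl.
Qed.

Lemma is_cycle_next2_neq c x : is_cycle c -> x \in c -> next c (next c x) != x.
Proof.
move=> cc xc; have [i [s [_ s0 cc' nE]]] := is_cycle_rot_to cc xc.
have := is_cycle_next_neq cc xc; rewrite -(nE (next c x)).
case: s s0 cc' nE => [//|z s] _ /is_cycle_uniq /=.
rewrite !inE !negb_or => /and3P[/and3P[_ xz _] _ _] _ /negPf ->.
by rewrite eqxx eq_sym.
Qed.

Lemma cycle_inhabited c : is_cycle c -> exists x, x \in c.
Proof. by case: c => [//|x s] _; exists x; rewrite mem_head. Qed.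

Lemma next_ind (c : seq G) (P : G -> Prop) x : uniq c -> x \in c -> P x ->
  (forall y, y \in c -> P y -> P (next c y)) -> forall y, y \in c -> P y.
Proof.
move=> uc xc Px Pn y yc.
have /iter_findex <- : fconnect (next c) x y by rewrite (fconnect_cycle (cycle_next uc)).
suff /(_ (findex (next c) x y))[] : forall n, iter n (next c) x \in c /\ P (iter n (next c) x) by [].
elim=> [|n [nc Pnx]] /=; first by [].
by rewrite mem_next; split=> //; apply: Pn.
Qed.

Lemma sconnect_sym x y : connect (@sedge G) x y = connect (@sedge G) y x.
Proof. exact/sym_connect_sym/sedge_sym. Qed.

Lemma mem_cycle_edges c x : x \in c -> [set x; next c x] \in cycle_edges c.
Proof. exact: imset_f. Qed.

Lemma set2_inj x y u v : [set x; y] = [set u; v] ->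
  (x = u /\ y = v) \/ (x = v /\ y = u).
Proof.
move=> E.
have : x \in [set u; v] by rewrite -E set21.
have : y \in [set u; v] by rewrite -E set22.
have : u \in [set x; y] by rewrite E set21.
have : v \in [set x; y] by rewrite E set22.
rewrite !inE => /orP[]/eqP vE /orP[]/eqP uE /orP[]/eqP yE /orP[]/eqP xE; 
  subst; auto.
Qed.

Lemma mem_edges x y : ([set x; y] \in edges G) = sedge x y.
Proof.
rewrite inE; apply/existsP/idP => [[u /existsP[v /andP[uv /eqP/set2_inj]]]|xy].
  by case=> -[-> ->] //; rewrite sedge_sym.
by exists x; apply/existsP; exists y; rewrite xy /=.
Qed.

Lemma cycle_edges_mem c x y : [set x; y] \in cycle_edges c ->
  (x \in c) && (y \in c).
Proof.
case/imsetP=> z zc /set2_inj[] [-> ->]; by rewrite mem_next zc.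
Qed.

Lemma eq_cycle_edges_mem c1 c2 : is_cycle c1 -> is_cycle c2 ->
  cycle_edges c1 = cycle_edges c2 -> c1 =i c2.
Proof.
move=> cc1 cc2 E x; apply/idP/idP => xc.
  by have := mem_cycle_edges xc; rewrite E => /cycle_edges_mem/andP[].
by have := mem_cycle_edges xc; rewrite -E => /cycle_edges_mem/andP[].
Qed.

End CycleBasics.

Section DeleteEdge.
Variables (G : sgraph) (a b : G).

Definition del_edge_rel : rel G :=
  fun u v => sedge u v && ([set u; v] != [set a; b]).

Lemma del_edge_sym : symmetric del_edge_rel.
Proof. by move=> u v; rewrite /del_edge_rel sedge_sym setUC. Qed.

Lemma del_edge_irrefl : irreflexive del_edge_rel.
Proof. by move=> u; rewrite /del_edge_rel sedge_irrefl. Qed.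

Definition del_edge : sgraph := SGraph del_edge_sym del_edge_irrefl.

Lemma edges_del_edge : edges del_edge = edges G :\ [set a; b] :> {set {set G}}.
Proof.
apply/setP=> E; rewrite !inE.
apply/existsP/andP => [[u /existsP[v /andP[/andP[uv nE] /eqP ->]]]|].
  by split=> //; apply/existsP; exists u; apply/existsP; exists v; rewrite uv /=.
case=> nE /existsP[u /existsP[v /andP[uv /eqP EE]]].
exists u; apply/existsP; exists v; rewrite EE eqxx andbT.
by rewrite /sedge /= /del_edge_rel uv -EE.
Qed.

Lemma card_edges_del_edge : sedge a b -> #|edges G| = #|edges del_edge|.+1.
Proof. by move=> ab; rewrite edges_del_edge (cardsD1 [set a; b]) mem_edges ab. Qed.

Lemma is_cycle_del_edge (c : seq G) :
  is_cycle (G := del_edge) c = is_cycle c && ([set a; b] \notin cycle_edges c).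
Proof.
rewrite /is_cycle; case: (2 < size c)%N => //=; case uc: (uniq c) => //=.
have uE : uniq c by rewrite uc.
apply/idP/andP => [cc | [cc ab]].
  split.
    by apply: sub_cycle cc => u v /andP[].
  apply/negP => /imsetP[u u_c E].
  by have /andP[_] := next_cycle cc u_c; rewrite E eqxx.
apply: (cycle_from_next (p := c)) => // u u_c.
rewrite /sedge /= /del_edge_rel next_cycle //=.
by apply: contraNneq ab => <-; apply: mem_cycle_edges.
Qed.

(** Closing a simple detour around an edge with the edge itself gives a cycle. *)
Lemma nonbridge_on_cycle : sedge a b ->
  connect (@sedge del_edge) b a ->
  exists c : seq G, [/\ is_cycle c, a \in c & next c a = b].
Proof.
move=> ab /connectP[p0 p0P aE].
case/shortenP: p0P aE => p pP up _ aE {p0}.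
case: p pP up aE => [_ _ aE|z p pP up aE].
  by move: ab; rewrite aE sedge_irrefl.
exists (b :: z :: p).
have E : next (b :: z :: p) a = b.
  rewrite -(next_rotr 1 up) lastI -aE rotr1_rcons /=.
  by rewrite eqxx.
split => //; last by rewrite aE mem_last.
have pG : path (@sedge G) b (z :: p) by apply: sub_path pP => u v /andP[].
rewrite /is_cycle up /cycle rcons_path pG -aE ab /= !andbT.
case: p pP aE {up E pG} => //= /andP[/andP[_ bz] _] az.
by rewrite az setUC eqxx in bz.
Qed.

End DeleteEdge.

Section DeleteCycleEdge.
Variables (G : sgraph) (c : seq G) (a : G).
Hypotheses (cc : is_cycle c) (ac : a \in c).

(** The rest of the cycle is a detour around the deleted edge. *)
Lemma connect_del_cycle_edge :
  connect (@sedge (del_edge a (next c a))) (next c a) a.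
Proof.
have [i [s [_ s0 cc' nE]]] := is_cycle_rot_to cc ac.
move: cc' nE; set b := next c a => cc' nE.
apply/connectP; exists (rcons s a); last by rewrite last_rcons.
have /and3P[_ /= /and3P[]] := cc'; rewrite inE negb_or => /andP[ab a_s] b_s us.
move=> /andP[_]; rewrite !rcons_path => /andP[bs la].
apply/andP; split.
  have : all (predC1 a) (b :: s).
    by rewrite /= eq_sym ab; apply/allP => z zs; apply: contraNneq a_s => <-.
  move=> /(@sub_in_path G (predC1 a) (@sedge G) (@sedge (del_edge a b))) -> //.
  move=> u v; rewrite !inE => ua va uv; rewrite /sedge /= /del_edge_rel uv /=.
  apply/eqP => /(@set2_inj G)[] [uE vE]; first by rewrite uE eqxx in ua.
  by rewrite vE eqxx in va.
rewrite /sedge /= /del_edge_rel la /=; apply/eqP => E.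
have : last b s \in [set a; b] by rewrite -E set21.
case: (s) s0 a_s b_s => //= z s' _ a_s b_s.
have := mem_last z s'; rewrite !inE => ls /orP[]/eqP le; rewrite le in ls.
  by rewrite inE ls in a_s.
by rewrite inE ls in b_s.
Qed.

Lemma connected_del_cycle_edge :
  connected_graph G -> connected_graph (del_edge a (next c a)).
Proof.
move=> Gc u v; apply: connect_sub (Gc u v) => {u v} u v uv.
have [E|nE] := eqVneq [set u; v] [set a; next c a]; last first.
  by apply: connect1; rewrite /sedge /= /del_edge_rel uv.
case: (set2_inj E) => -[-> ->]; last exact: connect_del_cycle_edge.
by rewrite (@sconnect_sym (del_edge a (next c a))); apply: connect_del_cycle_edge.
Qed.

End DeleteCycleEdge.

(** * The cyclomatic number of a connected graph *)

Definition acyclic (G : sgraph) := forall c : seq G, ~~ is_cycle c.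

Lemma exists_cycle_or_acyclic (G : sgraph) :
  (exists c : seq G, is_cycle c) \/ acyclic G.
Proof.
have [E0|[B]] := set_0Vmem (cycle_vsets G); last first.
  by move=> /cycle_vsetsP[c cc _]; left; exists c.
right=> c; apply/negP => cc.
have : [set x in c] \in cycle_vsets G by apply/cycle_vsetsP; exists c.
by rewrite E0 inE.
Qed.

(** The rank is the distance to [r]; a neighbour of smaller rank is the parent in a
   spanning tree. *)
Lemma connected_rank (G : sgraph) (r : G) : connected_graph G ->
  exists rk : G -> nat, forall v, v != r -> exists2 p, sedge v p & (rk p < rk v)%N.
Proof.
move=> Gc.
pose P v n := [exists p : n.-tuple G, path (@sedge G) r p && (last r p == v)].
have exP v : exists n, P v n.
  have /connectP[p pP pl] := Gc r v; exists (size p).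
  by apply/existsP; exists (in_tuple p); rewrite pP pl eqxx.
exists (fun v => ex_minn (exP v)) => v vr.
case: (ex_minnP (exP v)) => n /existsP[[p /= /eqP sp] /andP[pP /eqP pl]] _.
case/lastP: p pP pl sp => [_ /= rv|p w]; first by rewrite rv eqxx in vr.
rewrite rcons_path last_rcons size_rcons => /andP[pP pw] wv <-; exists (last r p).
  by rewrite sedge_sym -wv.
case: (ex_minnP (exP (last r p))) => m _; rewrite ltnS; apply.
by apply/existsP; exists (in_tuple p); rewrite pP eqxx.
Qed.

Lemma cyclomatic_connected (G : sgraph) (x : G) : connected_graph G ->
  cyclomatic G = (#|edges G|%:Z - #|G|%:Z + 1)%R.
Proof.
move=> Gc; rewrite /cyclomatic /num_components; congr (_ + _%:Z)%R.
rewrite -(n_comp_connect (sym_connect_sym (@sedge_sym G)) x).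
by apply: eq_n_comp_r => y; rewrite !inE; apply/esym/Gc.
Qed.

Lemma cyclomatic_empty (G : sgraph) : #|G| = 0%N -> cyclomatic G = 0.
Proof.
move=> G0; have noG (x : G) : False by have := fintype0 x.
rewrite /cyclomatic; have -> : edges G = set0.
  by apply/setP=> E; rewrite !inE; case: existsP => // -[x _]; case: (noG x).
have -> : num_components G = 0%N by apply: eq_card0 => y; case: (noG y).
by rewrite G0 cards0.
Qed.

(** The edges to the parents form a spanning tree, and any further edge would be
   bypassed by it, hence would close a cycle. *)
Lemma cyclomatic_acyclic (G : sgraph) :
  connected_graph G -> acyclic G -> cyclomatic G = 0.
Proof.
move=> Gc noC; case: (pickP (fun _ : G => true)) => [r _|G0]; last first.
  by apply: cyclomatic_empty; apply: eq_card0.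
rewrite (cyclomatic_connected r Gc).
have [rk rkP] := connected_rank r Gc.
pose par v := odflt r [pick p | sedge v p && (rk p < rk v)%N].
have parP v : v != r -> sedge v (par v) && (rk (par v) < rk v)%N.
  move=> /rkP[p vp lt_pv]; rewrite /par; case: pickP => [//|/(_ p)].
  by rewrite vp lt_pv.
pose f v := [set v; par v].
have f_inj : {in [set~ r] &, injective f}.
  move=> u v; rewrite !inE => /parP/andP[_ ur] /parP/andP[_ vr] /set2_inj[[]//|[uE vE]].
  by move: ur vr; rewrite vE -uE => /ltn_trans h /h; rewrite ltnn.
suff -> : edges G = f @: [set~ r].
  rewrite card_in_imset // cardsC1.
  have : (0 < #|G|)%N by apply/card_gt0P; exists r.
  by move: #|G| => n; lia.
apply/eqP; rewrite eqEsubset; apply/andP; split; last first.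
  apply/subsetP => _ /imsetP[v vr ->]; rewrite mem_edges.
  by rewrite !inE in vr; have /andP[] := parP v vr.
apply/subsetP => E; rewrite inE => /existsP[x /existsP[y /andP[xy /eqP ->]]].
apply/negPn/negP => notE.
have toR n v : (rk v < n)%N -> connect (@sedge (del_edge x y)) v r.
  elim: n v => // n IHn v; rewrite ltnS => vn.
  have [->|vr] := eqVneq v r; first exact: connect0.
  have /andP[vp lt_pv] := parP v vr.
  apply: (@connect_trans _ _ (par v)); last by apply: IHn; apply: leq_trans vn.
  apply: connect1; rewrite /sedge /= /del_edge_rel vp /=.
  by apply: contraNneq notE => <-; apply: imset_f; rewrite !inE.
have [|c [cc _ _]] := @nonbridge_on_cycle G x y xy; last by have := noC c; rewrite cc.
apply: (connect_trans (toR _ y (ltnSn _))).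
by rewrite (@sconnect_sym (del_edge x y)); apply: toR.
Qed.

Lemma cyclomatic_del_cycle_edge (G : sgraph) (c : seq G) a :
  connected_graph G -> is_cycle c -> a \in c ->
  cyclomatic G = (cyclomatic (del_edge a (next c a)) + 1)%R.
Proof.
move=> Gc cc ac; have Gc' := connected_del_cycle_edge cc ac Gc.
rewrite (cyclomatic_connected a Gc) (@cyclomatic_connected (del_edge a (next c a)) a Gc').
rewrite (card_edges_del_edge (is_cycle_next cc ac)) /=; lia.
Qed.

(** Deleting cycle edges one at a time reduces a connected graph to a tree. *)
Lemma connected_graph_ind (P : sgraph -> Prop) :
  (forall G, connected_graph G -> acyclic G -> P G) ->
  (forall (G : sgraph) (c : seq G) a, connected_graph G -> is_cycle c -> a \in c ->
     P (del_edge a (next c a)) -> P G) ->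
  forall G, connected_graph G -> P G.
Proof.
move=> Pa Pc G; have [n] := ubnP #|edges G|; elim: n G => // n IHn G ltn Gc.
have [[c cc]|noC] := exists_cycle_or_acyclic G; last exact: Pa.
case Dc: c cc => [//|a c'] cc.
have ac : a \in c by rewrite Dc mem_head.
rewrite -Dc in cc; apply: (Pc G c a) => //; apply: IHn.
  by move: ltn; rewrite (card_edges_del_edge (is_cycle_next cc ac)).
exact: connected_del_cycle_edge.
Qed.

Lemma leq_card_set1U (T : finType) (x : T) (U : {set T}) : (#|x |: U| <= #|U|.+1)%N.
Proof. by rewrite cardsU1; case: (_ \notin _). Qed.

(** Every deleted cycle edge is paid for by one of its ends. *)
Lemma cycle_transversal (G : sgraph) : connected_graph G ->
  exists2 U : {set G}, (#|U|%:Z <= cyclomatic G)%R &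
    forall c : seq G, is_cycle c -> exists2 x, x \in c & x \in U.
Proof.
move: G; apply: connected_graph_ind => [G Gc noC|G c a Gc cc ac [U leU tU]].
  exists set0; first by rewrite cards0 cyclomatic_acyclic.
  by move=> c cc; have := noC c; rewrite cc.
exists (a |: U).
  rewrite (cyclomatic_del_cycle_edge Gc cc ac).
  have := leq_card_set1U a U; move: leU => /=; lia.
move=> c' cc'; have [/cycle_edges_mem/andP[ac' _]|notin] :=
    boolP ([set a; next c a] \in cycle_edges c').
  by exists a; rewrite // setU11.
have [|x xc' xU] := tU c'; first by rewrite is_cycle_del_edge cc' notin.
by exists x; rewrite // inE xU orbT.
Qed.

(** Here no vertex has to pay for the first deleted edge, since the cycles through
   it are exempted. *)
Lemma cycle_transversal_but_one (G : sgraph) (c : seq G) a :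
  connected_graph G -> is_cycle c -> a \in c ->
  exists2 U : {set G}, (#|U|%:Z + 1 <= cyclomatic G)%R &
    forall c' : seq G, is_cycle c' -> [set a; next c a] \notin cycle_edges c' ->
      exists2 x, x \in c' & x \in U.
Proof.
move=> Gc cc ac.
have [U leU tU] := cycle_transversal (connected_del_cycle_edge cc ac Gc).
exists U; first by rewrite (cyclomatic_del_cycle_edge Gc cc ac); move: leU => /=; lia.
move=> c' cc' notin.
by have [|x xc' xU] := tU c'; [rewrite is_cycle_del_edge cc' notin | exists x].
Qed.

(** Walking along [c1] from a common vertex never leaves [c2]. *)
Lemma cycle_edges_sub_of_common (G : sgraph) (c1 c2 : seq G) u :
  is_cycle c1 -> is_cycle c2 -> u \in c1 -> u \in c2 ->
  (forall x, x \in c1 -> x \in c2 -> [set x; next c1 x] \in cycle_edges c2) ->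
  cycle_edges c1 \subset cycle_edges c2.
Proof.
move=> cc1 cc2 u1 u2 H.
have sub : forall x, x \in c1 -> x \in c2.
  apply: (next_ind (is_cycle_uniq cc1) u1 u2) => y y1 y2.
  by have /cycle_edges_mem/andP[] := H y y1 y2.
by apply/subsetP => _ /imsetP[x x1 ->]; apply: H => //; apply: sub.
Qed.

(** If two different cycles meet, then at some common vertex [x] one of them has
   an edge that the other misses.  Deleting that edge, and then an edge of the
   other cycle at [x], keeps the graph connected and lowers the cyclomatic number
   by two, while the single vertex [x] makes up for both. *)
Lemma cycles_disjoint_of_transversals (G : sgraph) :
  connected_graph G ->
  (forall U : {set G}, (#|U|%:Z + 1 <= cyclomatic G)%R ->
    exists2 c : seq G, is_cycle c & forall x, x \in c -> x \notin U) ->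
  cycles_disjoint G.
Proof.
move=> Gc large.
have main (c1 c2 : seq G) x : is_cycle c1 -> is_cycle c2 -> x \in c1 -> x \in c2 ->
    [set x; next c1 x] \in cycle_edges c2.
  move=> cc1 cc2 x1 x2; apply/negPn/negP => nin.
  pose G1 := del_edge x (next c1 x).
  have G1c : connected_graph G1 := connected_del_cycle_edge cc1 x1 Gc.
  have cc2' : is_cycle (G := G1) c2 by rewrite is_cycle_del_edge cc2.
  have [U leU tU] := @cycle_transversal_but_one G1 c2 x G1c cc2' x2.
  have [|c cc cU] := large (x |: U).
    rewrite (cyclomatic_del_cycle_edge Gc cc1 x1).
    have := leq_card_set1U x U; move: leU => /=; rewrite -/G1; lia.
  have nxc : x \notin c by apply/negP => /cU; rewrite setU11.
  have [||y yc yU] := tU c.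
  - rewrite is_cycle_del_edge cc /=; apply: contra nxc.
    by move/cycle_edges_mem/andP=> [].
  - by apply: contra nxc => /(@cycle_edges_mem G)/andP[].
  - by move: (cU y yc); rewrite !inE yU orbT.
move=> c1 c2 cc1 cc2 neq; rewrite disjoint_subset; apply/subsetP => x x1.
rewrite inE; apply/negP => x2; apply: neq; apply/eqP; rewrite eqEsubset.
rewrite (@cycle_edges_sub_of_common G c1 c2 x) //; last by move=> y; apply: main.
by rewrite (@cycle_edges_sub_of_common G c2 c1 x) // => y; apply: main.
Qed.

Section DisjointCycles.
Variable G : sgraph.
Hypothesis Gd : cycles_disjoint G.

Lemma eq_cycle_edges_of_meet (c1 c2 : seq G) x : is_cycle c1 -> is_cycle c2 ->
  x \in c1 -> x \in c2 -> cycle_edges c1 = cycle_edges c2.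
Proof.
move=> cc1 cc2 x1 x2; apply/eqP/negPn/negP => /eqP /(Gd cc1 cc2).
by rewrite disjoint_subset => /subsetP/(_ x x1); rewrite inE x2.
Qed.

Lemma eq_mem_of_meet (c1 c2 : seq G) x : is_cycle c1 -> is_cycle c2 ->
  x \in c1 -> x \in c2 -> c1 =i c2.
Proof.
by move=> cc1 cc2 x1 x2; apply/eq_cycle_edges_mem/(eq_cycle_edges_of_meet cc1 cc2 x1 x2).
Qed.

Lemma trivIset_cycle_vsets : trivIset (cycle_vsets G).
Proof.
apply/trivIsetP=> A B /cycle_vsetsP[c1 cc1 <-] /cycle_vsetsP[c2 cc2 <-] neq.
rewrite -setI_eq0; apply/eqP/setP => x; rewrite !inE; apply/negP => /andP[x1 x2].
case/negP: neq; apply/eqP/setP => y; rewrite !inE.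
exact: eq_mem_of_meet x1 x2 y.
Qed.

Lemma cycles_disjoint_del_edge a b : cycles_disjoint (@del_edge G a b).
Proof.
move=> c1 c2; rewrite !is_cycle_del_edge => /andP[cc1 _] /andP[cc2 _].
exact: Gd.
Qed.

(** A chord would close a second cycle meeting the first. *)
Lemma cycle_chordless (c : seq G) x y : is_cycle c -> x \in c -> y \in c ->
  sedge x y -> (y == next c x) || (x == next c y).
Proof.
move=> cc xc yc xy.
have [/imsetP[z zc /set2_inj[] [-> ->]]|nin] := boolP ([set x; y] \in cycle_edges c).
- by rewrite eqxx.
- by rewrite eqxx orbT.
have cc' : is_cycle (G := del_edge x y) c by rewrite is_cycle_del_edge cc.
have [|c' [cc2 xc' ny]] := @nonbridge_on_cycle G x y xy.
  by case/and3P: cc' => _ _ /connect_cycle; apply.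
case/negP: nin; rewrite -(eq_cycle_edges_of_meet cc2 cc xc' xc) -ny.
exact: mem_cycle_edges.
Qed.

End DisjointCycles.

(** Deleting an edge of a cycle destroys that cycle and no other. *)
Lemma card_cycle_vsets (G : sgraph) : connected_graph G -> cycles_disjoint G ->
  (#|cycle_vsets G|%:Z)%R = cyclomatic G.
Proof.
move: G; apply: connected_graph_ind => [G Gc noC Gd|G c a Gc cc ac IH Gd].
  rewrite cyclomatic_acyclic //; apply/eqP; rewrite eqz_nat cards_eq0.
  apply/eqP/setP => B; rewrite in_set0; apply/negP => /cycle_vsetsP[c cc _].
  by have := noC c; rewrite cc.
rewrite (cyclomatic_del_cycle_edge Gc cc ac) -IH; last exact: cycles_disjoint_del_edge.
have cB : [set x in c] \in cycle_vsets G by apply/cycle_vsetsP; exists c.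
suff -> : cycle_vsets (del_edge a (next c a)) = cycle_vsets G :\ [set x in c] :> {set {set G}}.
  by rewrite (cardsD1 [set x in c]) cB PoszD addrC.
apply/setP=> B; apply/idP/setD1P => [|[nB /cycle_vsetsP[c' cc' EB]]].
  move=> /(@cycle_vsetsP (del_edge a (next c a)))[c'].
  rewrite is_cycle_del_edge => /andP[cc' nin] EB; split.
    apply: contraNneq nin => E.
    have ac' : a \in c' by have : a \in B; [rewrite E inE | rewrite -EB inE].
    by rewrite (eq_cycle_edges_of_meet Gd cc' cc ac' ac) mem_cycle_edges.
  by apply/cycle_vsetsP; exists c'.
apply/(@cycle_vsetsP (del_edge a (next c a))); exists c' => //.
rewrite is_cycle_del_edge cc' /=; apply: contra nB => /cycle_edges_mem/andP[ac' _].
by rewrite -EB; apply/eqP/setP => x; rewrite !inE; apply: (eq_mem_of_meet Gd cc' cc ac' ac).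
Qed.

(** * Matchings as involutions *)

(** The mate function of a perfect matching of the subgraph induced on [S]; its
   values outside [S] are arbitrary. *)
Definition pairing (G : sgraph) (S : {set G}) (mu : G -> G) :=
  forall x, x \in S -> [/\ mu x \in S, mu (mu x) = x & sedge x (mu x)].

Section Pairings.
Variable G : sgraph.
Implicit Types (S A X : {set G}) (mu : G -> G).

Lemma pairing_neq S mu x : pairing S mu -> x \in S -> mu x != x.
Proof.
move=> pS xS; apply/negP => /eqP E; have [_ _] := pS x xS.
by rewrite E sedge_irrefl.
Qed.

Lemma card_matching (M : {set {set G}}) : matching M -> #|cover M| = (#|M| * 2)%N.
Proof.
case/andP=> /subsetP ME tM; apply: card_uniform_partition => [B /ME|].
  rewrite inE => /existsP[x /existsP[y /andP[xy /eqP ->]]].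
  by rewrite cards2; case: eqVneq xy => // ->; rewrite sedge_irrefl.
rewrite /partition eqxx tM; apply/negP => /ME; rewrite inE.
move=> /existsP[x /existsP[y /andP[_ /eqP]]] /setP/(_ x).
by rewrite !inE eqxx.
Qed.

Lemma pairing_matching S mu : pairing S mu ->
  exists2 M : {set {set G}}, matching M & cover M = S.
Proof.
move=> pS; pose M := [set [set x; mu x] | x in S].
have eqB x y z : x \in S -> y \in S -> z \in [set x; mu x] -> z \in [set y; mu y] ->
    [set x; mu x] = [set y; mu y].
  move=> /pS[_ mmx _] /pS[_ mmy _]; rewrite !inE.
  move=> /orP[]/eqP -> /orP[]/eqP E; rewrite -?E ?E ?mmy //; last first.
  - by rewrite -mmx E mmy.
  - by rewrite -mmx E setUC.
  - by rewrite setUC.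
exists M.
  apply/andP; split.
    by apply/subsetP => _ /imsetP[x /pS[_ _ e] ->]; rewrite mem_edges.
  apply/trivIsetP => _ _ /imsetP[x xS ->] /imsetP[y yS ->] neq.
  rewrite -setI_eq0; apply/eqP/setP => z; rewrite !in_setI in_set0.
  apply/negP => /andP[zx zy]; case/negP: neq; apply/eqP; exact: eqB zx zy.
apply/setP => x; apply/bigcupP/idP => [[_ /imsetP[y yS ->]]|xS].
  by rewrite !inE => /orP[]/eqP -> //; have [] := pS y yS.
by exists [set x; mu x]; [apply: imset_f | rewrite set21].
Qed.

Lemma pairing_even S mu : pairing S mu -> ~~ odd #|S|.
Proof.
by case/pairing_matching=> M mM <-; rewrite (card_matching mM) oddM andbF.
Qed.

Lemma pairing_leq S mu : pairing S mu -> (#|S| <= 2 * matching_number G)%N.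
Proof.
case/pairing_matching=> M mM <-; rewrite (card_matching mM) mulnC leq_mul2l /=.
by rewrite /matching_number; apply: leq_bigmax_cond.
Qed.

Definition avoiding S (U : {set G}) mu : {set G} :=
  [set x in S | (x \notin U) && (mu x \notin U)].

Lemma avoiding_sub S (U : {set G}) mu : {subset avoiding S U mu <= S}.
Proof. by move=> x; rewrite inE => /andP[]. Qed.

Lemma avoiding_notin S (U : {set G}) mu x : x \in avoiding S U mu -> x \notin U.
Proof. by rewrite inE => /and3P[]. Qed.

(** Each vertex of [U] spoils at most one pair, that is, two vertices. *)
Lemma pairing_avoid S mu (U : {set G}) : pairing S mu ->
  pairing (avoiding S U mu) mu /\ (#|S| <= #|avoiding S U mu| + 2 * #|U|)%N.
Proof.
move=> pS; split.
  move=> x; rewrite !inE => /and3P[xS xU mxU]; have [mS mm e] := pS x xS.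
  by rewrite mS mm xU mxU.
have sub : S \subset avoiding S U mu :|: (U :|: [set mu x | x in U]).
  apply/subsetP => x xS; rewrite !inE xS /=.
  case: (boolP (x \in U)) => //= xU; rewrite ?orbT //.
  case: (boolP (mu x \in U)) => //= mU; apply/imsetP; exists (mu x) => //.
  by have [_ ->] := pS x xS.
apply: leq_trans (subset_leq_card sub) _; apply: leq_trans (leq_card_setU _ _) _.
rewrite leq_add2l (leq_trans (leq_card_setU _ _)) // mul2n -addnn leq_add2l.
exact: leq_imset_card.
Qed.

Lemma matching_number_pairing :
  exists S mu, pairing S mu /\ #|S| = (2 * matching_number G)%N.
Proof.
have [|M mM mE] := @eq_bigmax_cond _ (fun M => @matching G M) (fun M : {set {set G}} => #|M|).
  apply/card_gt0P; exists set0; rewrite unfold_in /= /matching sub0set /=.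
  by apply/trivIsetP => A; rewrite inE.
pose mu x := odflt x [pick y | ([set x; y] \in M) && sedge x y].
exists (cover M), mu; split; last by rewrite card_matching // mulnC /matching_number -mE.
case/andP: mM => /subsetP ME tM.
have mates x : x \in cover M -> exists y, ([set x; y] \in M) && sedge x y.
  case/bigcupP=> B BM xB; have := ME B BM; rewrite inE.
  move=> /existsP[u /existsP[v /andP[uv /eqP EB]]].
  move: xB; rewrite EB !inE => /orP[]/eqP ->.
    by exists v; rewrite -EB BM.
  by exists u; rewrite setUC -EB BM sedge_sym.
have uniqM x y z : [set x; y] \in M -> [set x; z] \in M -> sedge x y -> y = z.
  move=> xyM xzM xy; apply/eqP; rewrite -[_ == _]negbK; apply/negP => yz.
  have /trivIsetP/(_ _ _ xyM xzM) := tM; rewrite -setI_eq0.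
  have neq : [set x; y] != [set x; z].
    apply: contra yz => /eqP /set2_inj[[_ ->]//|[xz yx]].
    by rewrite yx sedge_irrefl in xy.
  by move/(_ neq)/eqP/setP/(_ x); rewrite !inE eqxx.
have muP x : x \in cover M -> ([set x; mu x] \in M) && sedge x (mu x).
  by move/mates=> [y yP]; rewrite /mu; case: pickP => [//|/(_ y)]; rewrite yP.
move=> x xS; have /andP[xM e] := muP x xS.
have mS : mu x \in cover M by apply/bigcupP; exists [set x; mu x]; rewrite ?set22.
split=> //; have /andP[mM e'] := muP _ mS.
by apply: uniqM mM _ e'; rewrite setUC.
Qed.

(** Grow an alternating path from [w] by two vertices at a time, ending with a mate.
   If the end [h] has a neighbour besides its mate, then either the path can be
   prolonged or that neighbour closes a cycle with the final part of the path.
   A cycle through [w] consists of the whole path, which is closed under [mu]. *)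
Lemma alternating_path S mu w : pairing S mu -> w \in S ->
  (exists c : seq G, [/\ is_cycle c, {subset c <= S} &
     w \in c -> forall x, x \in c -> mu x \in c]) \/
  (exists h, [/\ h \in S, h != w, forall z, z \in S -> sedge h z -> z = mu h &
     connect [rel u v | [&& u \in S, v \in S & sedge u v]] w h]).
Proof.
move=> pS wS.
suff grow n (h : G) (s : seq G) : (#|S| < size s + n)%N -> uniq (h :: mu h :: s) ->
    path (@sedge G) h (mu h :: s) -> {subset h :: mu h :: s <= S} ->
    {in h :: mu h :: s, forall x, mu x \in h :: mu h :: s} ->
    last (mu h) s = w ->
    (exists c : seq G, [/\ is_cycle c, {subset c <= S} &
       w \in c -> forall x, x \in c -> mu x \in c]) \/
    (exists h, [/\ h \in S, h != w, forall z, z \in S -> sedge h z -> z = mu h &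
       connect [rel u v | [&& u \in S, v \in S & sedge u v]] w h]).
  have [mS mm e] := pS w wS.
  apply: (grow #|S|.+1 (mu w) [::]) => //=; rewrite ?mm ?andbT //.
  - by rewrite inE (pairing_neq pS).
  - by rewrite sedge_sym.
  - by move=> x; rewrite !inE => /orP[]/eqP ->.
  - by move=> x; rewrite !inE => /orP[]/eqP ->; rewrite ?mm eqxx ?orbT.
elim: n h s => [|n IHn] h s ltn us ps sS cs lw.
  have : (size [:: h, mu h & s] <= #|S|)%N.
    by rewrite cardE; apply: uniq_leq_size us _ => x /sS; rewrite mem_enum.
  move=> /=; lia.
have hS : h \in S by apply: sS; rewrite mem_head.
have [mhS mmh eh] := pS h hS.
case: (pickP (fun z => [&& z \in S, sedge h z & z != mu h])) => [z|noz]; last first.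
  right; exists h; split=> //.
  - by rewrite -lw; move: us => /= /andP[hn _]; apply: contraNneq hn => {1}->; apply: mem_last.
  - by move=> z zS hz; have /negbT := noz z; rewrite zS hz /= negbK => /eqP.
  - have csym : connect_sym [rel u v | [&& u \in S, v \in S & sedge u v]].
      by apply: sym_connect_sym => u v /=; rewrite sedge_sym andbCA.
    rewrite csym; apply/connectP; exists (mu h :: s) => //.
    apply: (@sub_in_path _ (mem S) (@sedge G)) ps; last by apply/allP.
    by move=> u v uS vS /= ->; rewrite uS vS.
case/and3P=> zS hz zmh.
have [zs|nzs] := boolP (z \in h :: mu h :: s); last first.
  have [mzS mmz ez] := pS z zS.
  have nmz : mu z \notin h :: mu h :: s by apply: contra nzs => /cs; rewrite mmz.
  apply: (IHn (mu z) [:: h, mu h & s]).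
  - by apply: leq_trans ltn _; rewrite /= addnS !addSn ltnS leqnSn.
  - rewrite mmz cons_uniq (cons_uniq z) nzs us !andbT in_cons negb_or nmz.
    by rewrite (pairing_neq pS).
  - by rewrite mmz; move: ps => /= ->; rewrite sedge_sym ez sedge_sym hz.
  - by rewrite mmz => x; rewrite !(in_cons (mu z), in_cons z) => /or3P[/eqP->|/eqP->|/sS].
  - rewrite mmz => x; rewrite !(in_cons (mu z), in_cons z).
    case/or3P=> [/eqP->|/eqP->|/cs xs].
    + by rewrite mmz eqxx orbT.
    + by rewrite eqxx.
    + by rewrite xs !orbT.
  - by [].
left; have zs' : z \in s.
  move: zs; rewrite !inE (negPf zmh) /=; case: eqVneq hz => // ->.
  by rewrite sedge_irrefl.
case/splitPr: zs' => p1 p2 in ltn us ps sS cs lw zs *.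
have E : h :: mu h :: p1 ++ z :: p2 = (h :: mu h :: rcons p1 z) ++ p2.
  by rewrite /= cat_rcons.
exists (h :: mu h :: rcons p1 z); split.
- rewrite /is_cycle /= size_rcons /=.
  move: us; rewrite E cat_uniq => /andP[/= -> _] /=.
  rewrite eh rcons_path last_rcons sedge_sym hz andbT.
  by move: ps => /= /andP[_]; rewrite -cat_rcons cat_path => /andP[].
- by move=> x xc; apply: sS; rewrite E mem_cat xc.
- case: p2 E us cs lw {ltn ps sS zs} => [|t p2] E us cs lw; rewrite E in us cs.
    by rewrite cats0 in cs => _.
  have wp : w \in t :: p2 by rewrite -lw last_cat /= mem_last.
  move: us; rewrite cat_uniq => /and3P[_ /hasPn/(_ w wp) nw _] wc.
  by rewrite /= wc in nw.
Qed.

End Pairings.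

(** * Vertex covers of forests *)

Section Forests.
Variable G : sgraph.
Hypothesis noC : acyclic G.

(** The end of a path that cannot be prolonged has only its predecessor as
   neighbour, unless a cycle is closed. *)
Lemma forest_leaf (A : {set G}) x y : x \in A -> y \in A -> sedge x y ->
  exists h k, [/\ h \in A, k \in A, sedge h k &
                 forall z, z \in A -> sedge h z -> z = k].
Proof.
move=> xA yA xy.
suff grow n (h k : G) (s : seq G) : (#|A| < size s + n)%N -> uniq (h :: k :: s) ->
    path (@sedge G) h (k :: s) -> {subset h :: k :: s <= A} ->
    exists h k, [/\ h \in A, k \in A, sedge h k &
                   forall z, z \in A -> sedge h z -> z = k].
  apply: (grow #|A|.+1 x y [::]) => //=; rewrite ?xy ?andbT //.
    by rewrite inE; apply: contraTneq xy => ->; rewrite sedge_irrefl.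
  by move=> z; rewrite !inE => /orP[]/eqP ->.
elim: n h k s => [|n IHn] h k s ltn us ps sA.
  have : (size [:: h, k & s] <= #|A|)%N.
    by rewrite cardE; apply: uniq_leq_size us _ => z /sA; rewrite mem_enum.
  move=> /=; lia.
have hA : h \in A by apply: sA; rewrite !inE eqxx.
have kA : k \in A by apply: sA; rewrite !inE eqxx orbT.
have /andP[hk _] := ps; have ps' : path (@sedge G) k s by case/andP: ps.
case: (pickP (fun z => [&& z \in A, sedge h z & z != k])) => [z|noz]; last first.
  exists h, k; split=> // z zA hz; have /negbT := noz z.
  by rewrite zA hz /= negbK => /eqP.
case/and3P=> zA hz zk.
have [zs|nzs] := boolP (z \in h :: k :: s); last first.
  apply: (IHn z h (k :: s)).
  - by move: ltn; rewrite /= addSnnS.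
  - by rewrite cons_uniq nzs.
  - by move: ps => /= ->; rewrite sedge_sym hz.
  - by move=> u; rewrite in_cons => /predU1P[->|/sA].
have zs' : z \in s.
  move: zs; rewrite !inE (negPf zk) /=; case: eqVneq hz => // ->.
  by rewrite sedge_irrefl.
case/splitPr: zs' us ps' => p1 p2 us ps'; exfalso.
have /negP[] := noC (h :: k :: rcons p1 z).
rewrite /is_cycle /= size_rcons /= hk rcons_path last_rcons sedge_sym hz andbT.
move: us; rewrite -cat_rcons -!cat_cons cat_uniq => /andP[/= -> _] /=.
by move: ps'; rewrite -cat_rcons cat_path => /andP[].
Qed.

(** A leaf is matched to its neighbour, which covers all the edges at both. *)
Lemma forest_konig (A : {set G}) : exists (X S : {set G}) (mu : G -> G),
  [/\ forall x y, x \in A -> y \in A -> sedge x y -> (x \in X) || (y \in X),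
      S \subset A, pairing S mu & (2 * #|X| <= #|S|)%N].
Proof.
have [n] := ubnP #|A|; elim: n A => // n IHn A ltA.
case: (pickP (fun p : G * G => [&& p.1 \in A, p.2 \in A & sedge p.1 p.2])); last first.
  move=> noE; exists set0, set0, id; split; rewrite ?sub0set ?cards0 //.
    by move=> x y xA yA xy; have := noE (x, y); rewrite /= xA yA xy.
  by move=> x; rewrite inE.
move=> [x0 y0] /= /and3P[xA0 yA0 xy0].
have [x [y [xA yA xy xP]]] := forest_leaf xA0 yA0 xy0.
have nxy : x != y by apply: contraTneq xy => ->; rewrite sedge_irrefl.
have [|X [S [mu [cX sSA pS cS]]]] := IHn (A :\ x :\ y).
  by move: ltA; rewrite (cardsD1 x A) xA (cardsD1 y (A :\ x)) !inE eq_sym nxy yA /=; lia.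
have [xS yS] : x \notin S /\ y \notin S.
  by split; apply: contraTN isT => /(subsetP sSA); rewrite !inE eqxx ?andbF.
exists (y |: X), (x |: (y |: S)),
  (fun z => if z == x then y else if z == y then x else mu z); split.
- move=> u v uA vA uv; rewrite !inE.
  case: (eqVneq u y) => //= uy; case: (eqVneq v y) => [|vy]; rewrite ?orbT //=.
  case: (eqVneq u x) => [ux|ux].
    by rewrite ux in uv; rewrite (xP v vA uv) eqxx in vy.
  case: (eqVneq v x) => [vx|vx].
    by rewrite sedge_sym vx in uv; rewrite (xP u uA uv) eqxx in uy.
  by apply: cX; rewrite // !inE ?uy ?ux ?vy ?vx.
- apply/subsetP => z; rewrite !inE => /or3P[/eqP->|/eqP->|/(subsetP sSA)] //.
  by rewrite !inE => /and3P[].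
- have nyx : (y == x) = false by rewrite eq_sym (negPf nxy).
  move=> z; rewrite !inE; case: (eqVneq z x) => [-> _|zx] /=.
    by rewrite !eqxx nyx orbT.
  case: (eqVneq z y) => [-> _|zy] /=.
    by rewrite !eqxx sedge_sym.
  move=> zS.
  have [mS mm e] := pS z zS.
  rewrite mS !orbT e mm !ifN //; first by apply: contraNneq yS => <-.
  by apply: contraNneq xS => <-.
- rewrite (cardsU1 x) !inE (negPf nxy) (negPf xS) (cardsU1 y S) yS /=.
  by have := leq_card_set1U y X; lia.
Qed.

End Forests.

(** * Positions along an even cycle *)

(** Each class is mapped injectively into the other one. *)
Lemma card_flip (T : finType) (A : {set T}) (f : T -> T) (chi : T -> bool) :
  {in A &, injective f} -> (forall x, x \in A -> f x \in A /\ chi (f x) = ~~ chi x) ->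
  (2 * #|[set x in A | ~~ chi x]| = #|A|)%N.
Proof.
move=> f_inj fA; pose P b := [set x in A | chi x == b].
have leP b : (#|P b| <= #|P (~~ b)|)%N.
  rewrite -(card_in_imset (f := f)); last first.
    by move=> x y; rewrite !inE => /andP[xA _] /andP[yA _]; apply: f_inj.
  apply/subset_leq_card/subsetP => _ /imsetP[x + ->].
  by rewrite !inE => /andP[xA /eqP <-]; have [-> ->] := fA x xA; rewrite eqxx.
have -> : [set x in A | ~~ chi x] = P false.
  by apply/setP => x; rewrite !inE eqbF_neg.
have : #|A| = (#|P false| + #|P true|)%N.
  rewrite -(cardsID (P true) A) addnC.
  by congr (_ + _)%N; apply: eq_card => x; rewrite !inE;
     case: (x \in A); case: (chi x).
have := leP true; have := leP false => /=; lia.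
Qed.

Section Positions.
Variables (G : sgraph) (c : seq G).
Hypothesis cc : is_cycle c.

Definition odd_pos x := odd (index x c).

Lemma size_cycle_gt0 : (0 < size c)%N.
Proof. by case/and3P: cc => /ltnW/ltnW. Qed.

Lemma index_next x : x \in c ->
  index (next c x) c = if ((index x c).+1 == size c) then 0%N else (index x c).+1.
Proof.
move=> xc; rewrite next_nth xc; case Dc: c (xc) => [//|y p] xp.
have uc : uniq (y :: p) by rewrite -Dc; apply: is_cycle_uniq.
have : (index x (y :: p) <= size p)%N by have := index_mem x (y :: p); rewrite xp /= ltnS.
move: (index x _) => i; rewrite leq_eqVlt => /orP[/eqP ->|ltip].
  by rewrite nth_default //= !eqxx.
rewrite -[nth y p i]/(nth y (y :: p) i.+1) index_uniq //=.
by rewrite eqSS (ltn_eqF ltip).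
Qed.

Section Walk.
Variable x0 : G.

Definition walk j := iter j (next c) (head x0 c).

Lemma walkS j : walk j.+1 = next c (walk j).
Proof. by []. Qed.

Lemma walk0 : walk 0 = head x0 c.
Proof. by []. Qed.

Lemma mem_walk j : walk j \in c.
Proof.
elim: j => [|j IHj]; last by rewrite walkS mem_next.
by rewrite walk0 -nth0 mem_nth // size_cycle_gt0.
Qed.

Lemma walk_nth j : (j < size c)%N -> walk j = nth x0 c j.
Proof.
elim: j => [|j IHj] ltj; first by rewrite nth0.
rewrite walkS IHj ?(ltnW ltj) // next_nth mem_nth ?(ltnW ltj) //.
have := ltj; have := is_cycle_uniq cc; case: (c) => [//|y p] uc lt'.
by rewrite index_uniq ?(ltnW lt') //=; apply: set_nth_default.
Qed.

Lemma walk_index x : x \in c -> walk (index x c) = x.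
Proof. by move=> xc; rewrite walk_nth ?index_mem // nth_index. Qed.

Lemma walk_size : walk (size c) = walk 0.
Proof.
have s0 := size_cycle_gt0; have lts : ((size c).-1 < size c)%N by rewrite prednK.
rewrite -{1}(prednK s0) walkS walk_nth //.
have xc : nth x0 c (size c).-1 \in c by rewrite mem_nth.
have := index_next xc; rewrite index_uniq ?is_cycle_uniq // prednK // eqxx.
move=> i0; have := nth_index x0 (_ : next c (nth x0 c (size c).-1) \in c).
by rewrite mem_next xc i0 nth0 => <-.
Qed.

Lemma walk_edge j : sedge (walk j) (walk j.+1).
Proof. by rewrite walkS is_cycle_next // mem_walk. Qed.

End Walk.

Hypothesis even_size : ~~ odd (size c).

Lemma odd_pos_next x : x \in c -> odd_pos (next c x) = ~~ odd_pos x.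
Proof.
move=> xc; rewrite /odd_pos index_next //; case: eqP => //= E.
by move: even_size; rewrite -E /= negbK => ->.
Qed.

Lemma odd_pos_prev x : x \in c -> odd_pos (prev c x) = ~~ odd_pos x.
Proof.
move=> xc; have := @odd_pos_next (prev c x); rewrite mem_prev next_prev ?is_cycle_uniq //.
by move/(_ xc) ->; rewrite negbK.
Qed.

Lemma odd_pos_walk x0 j : odd_pos (walk x0 j) = odd j.
Proof.
elim: j => [|j IHj]; last by rewrite walkS odd_pos_next ?mem_walk // IHj.
by rewrite walk0 /odd_pos; case: (c) => //= y s; rewrite eqxx.
Qed.

Lemma card_cycle_set : #|[set x in c]| = size c.
Proof. by rewrite cardsE (card_uniqP (is_cycle_uniq cc)). Qed.

Lemma card_even_pos : (2 * #|[set x in c | ~~ odd_pos x]| = size c)%N.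
Proof.
rewrite -card_cycle_set -(@card_flip _ [set x in c] (next c) odd_pos).
- by congr (2 * _)%N; apply: eq_card => x; rewrite !inE.
- by move=> x y _ _; apply: (can_inj (prev_next (is_cycle_uniq cc))).
- by move=> x; rewrite !inE mem_next => xc; rewrite odd_pos_next.
Qed.

End Positions.

(** * Graphs with disjoint cycles and their contraction *)

Section Blocks.
Variable G : sgraph.
Hypothesis Gd : cycles_disjoint G.
Let O := cycle_vertices G.
Let V := cycle_vsets G.
Let T := contract_cycles G.

(** A listing of the cycle through [x] that depends only on its vertex set, so that
   all vertices of a cycle agree on their positions. *)
Definition cycle_through (x : G) : seq G :=
  if [pick c : #|pblock V x|.-tuple G | is_cycle c && ([set y in c] == pblock V x)]
    is Some c then tval c else [::].

Lemma cycle_throughP x : x \in O ->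
  is_cycle (cycle_through x) /\ [set y in cycle_through x] = pblock V x.
Proof.
move=> xO; have := pblock_mem (xO : x \in cover V).
rewrite inE => /existsP[c cP]; rewrite /cycle_through.
by case: pickP => [c' /andP[cc /eqP E]|/(_ c)]; rewrite ?cP.
Qed.

Lemma is_cycle_through x : x \in O -> is_cycle (cycle_through x).
Proof. by case/cycle_throughP. Qed.

Lemma mem_cycle_through x : x \in O -> x \in cycle_through x.
Proof.
move=> xO; have [_ E] := cycle_throughP xO.
have : x \in pblock V x by rewrite mem_pblock.
by rewrite -E inE.
Qed.

Lemma mem_cycle_vertices (c : seq G) x : is_cycle c -> x \in c -> x \in O.
Proof. by move=> cc xc; apply/cycle_verticesP; exists c. Qed.

Lemma mem_cycle_throughO x y : x \in O -> y \in cycle_through x -> y \in O.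
Proof. by move=> xO; apply: mem_cycle_vertices (is_cycle_through xO). Qed.

Lemma eq_cycle_through x y : x \in O -> y \in cycle_through x ->
  cycle_through y = cycle_through x.
Proof.
move=> xO yx; have [_ E] := cycle_throughP xO.
have yp : y \in pblock V x by rewrite -E inE.
by rewrite /cycle_through (same_pblock (trivIset_cycle_vsets Gd) yp).
Qed.

Lemma next_through_inj : {in O &, injective (fun x => next (cycle_through x) x)}.
Proof.
move=> x y xO yO /= E.
have cE : cycle_through x = cycle_through y.
  rewrite -(@eq_cycle_through x (next (cycle_through x) x)) ?mem_next ?mem_cycle_through //.
  by rewrite E (@eq_cycle_through y) ?mem_next ?mem_cycle_through.
move: E; rewrite cE; apply: (can_inj (prev_next _)).
by apply: is_cycle_uniq; apply: is_cycle_through.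
Qed.

Lemma trivIset_blocks : trivIset (contract_blocks G).
Proof.
have VS A x : A \in V -> x \notin O -> [disjoint A & [set x]].
  move=> AV xO; rewrite disjoint_sym disjoints1; apply: contra xO => xA.
  by apply/bigcupP; exists A.
apply/trivIsetP=> A B; rewrite !in_setU.
move=> /orP[AV|/imsetP[x + ->]] /orP[BV|/imsetP[y + ->]].
- exact: (trivIsetP (trivIset_cycle_vsets Gd)).
- by rewrite inE => yO _; apply: VS.
- by rewrite inE => xO _; rewrite disjoint_sym; apply: VS.
- move=> _ _ neq; rewrite disjoints1 inE; apply: contraNneq neq => ->; exact: eqxx.
Qed.

Lemma cover_blocks x : x \in cover (contract_blocks G).
Proof.
apply/bigcupP; have [xO|xO] := boolP (x \in O).
  have /bigcupP[B BV xB] := xO; exists B => //; by rewrite in_setU BV.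
exists [set x]; rewrite ?set11 // in_setU; apply/orP; right.
by apply: imset_f; rewrite inE.
Qed.

Definition block_of (x : G) : T :=
  exist _ (pblock (contract_blocks G) x) (pblock_mem (cover_blocks x)).

Lemma mem_block_of x : x \in val (block_of x).
Proof. by rewrite /= mem_pblock cover_blocks. Qed.

Lemma block_of_mem (B : T) x : x \in val B -> block_of x = B.
Proof.
by move=> xB; apply: val_inj; apply: def_pblock (valP B) xB; apply: trivIset_blocks.
Qed.

Lemma mem_block (B : T) x : (x \in val B) = (block_of x == B).
Proof. by apply/idP/eqP => [/block_of_mem|<-] //; apply: mem_block_of. Qed.

Lemma block_of_O x : x \in O -> val (block_of x) \in V.
Proof.
move=> xO; have xV : x \in cover V := xO.
have BV := pblock_mem xV; pose B : T := exist _ (pblock V x) (subsetP (subsetUl _ _) _ BV).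
by rewrite (@block_of_mem B x) //= mem_pblock.
Qed.

Lemma block_of_notO x : x \notin O -> val (block_of x) = [set x].
Proof.
move=> xO; have BS : [set x] \in contract_blocks G.
  by rewrite in_setU; apply/orP; right; apply: imset_f; rewrite inE.
pose B : T := exist _ [set x] BS.
by rewrite (@block_of_mem B x) //= set11.
Qed.

Lemma block_ofV x : (val (block_of x) \in V) = (x \in O).
Proof.
apply/idP/idP => [BV|]; last exact: block_of_O.
by apply/bigcupP; exists (val (block_of x)) => //; apply: mem_block_of.
Qed.

Lemma block_of_through x y : x \in O -> (y \in cycle_through x) = (block_of y == block_of x).
Proof.
move=> xO; rewrite -mem_block; have := block_of_O xO.
have [_ E] := cycle_throughP xO; move=> BV.
have <- : pblock V x = val (block_of x).
  by apply: def_pblock BV (mem_block_of x); apply: trivIset_cycle_vsets.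
by rewrite -E inE.
Qed.

Lemma block_nonempty (B : T) : exists x, x \in val B.
Proof.
have := valP B; rewrite in_setU => /orP[/cycle_vsetsP[c cc <-]|/imsetP[x _ ->]].
  have := size_cycle_gt0 cc; case: (c) => // x s _.
  by exists x; rewrite inE mem_head.
by exists x; rewrite set11.
Qed.

Lemma same_block_cycle x y : x != y -> block_of x = block_of y ->
  (x \in O) && (y \in cycle_through x).
Proof.
move=> xy E; have xO : x \in O.
  apply: contraNT xy => xO; have := mem_block_of y; rewrite -E block_of_notO //.
  by rewrite inE eq_sym.
by rewrite xO block_of_through // E eqxx.
Qed.

Lemma contract_edgeP (A B : T) :
  reflect (A <> B /\ exists x y, [/\ x \in val A, y \in val B & sedge x y]) (sedge A B).
Proof.
apply: (iffP andP) => [[/eqP nAB /existsP[x /andP[xA /existsP[y /andP[yB xy]]]]]|].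
  by split=> //; exists x, y.
case=> /eqP nAB [x [y [xA yB xy]]]; split=> //; apply/existsP; exists x; rewrite xA.
by apply/existsP; exists y; rewrite yB.
Qed.

Lemma block_edge x y : sedge x y -> block_of x <> block_of y ->
  sedge (block_of x) (block_of y).
Proof.
move=> xy nB; apply/contract_edgeP; split=> //; exists x, y.
by rewrite !mem_block_of.
Qed.

(** An edge of a cycle of the contraction is no bridge of the graph, hence lies on
   a cycle of the graph, although it joins two different blocks. *)
Lemma contract_acyclic : acyclic T.
Proof.
move=> bs; apply/negP => cbs.
have [B1 B1s] : exists B, B \in bs by exact: cycle_inhabited.
have B12 := is_cycle_next cbs B1s; have con := connect_del_cycle_edge cbs B1s.
move: (next bs B1) B12 con => B2 B12 con.
have [nB [x [y [xB1 yB2 xy]]]] := contract_edgeP _ _ B12.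
have bx := block_of_mem xB1; have by_ := block_of_mem yB2.
have same u v : block_of u = block_of v -> connect (@sedge (del_edge x y)) u v.
  move=> E; have [->|uv] := eqVneq u v; first exact: connect0.
  have /andP[uO vc] := same_block_cycle uv E.
  have cc : is_cycle (G := del_edge x y) (cycle_through u).
    rewrite is_cycle_del_edge is_cycle_through //=.
    apply/negP => /cycle_edges_mem; rewrite !block_of_through // bx by_.
    by move=> /andP[/eqP E1 /eqP E2]; apply: nB; rewrite E1 E2.
  case/and3P: cc => _ _ /connect_cycle; apply=> //.
  exact: mem_cycle_through.
have lift A B : connect (@sedge (del_edge B1 B2)) A B ->
    forall u v, block_of u = A -> block_of v = B -> connect (@sedge (del_edge x y)) u v.
  case/connectP=> p; elim: p A => [|A' p IHp] A /=.
    by move=> _ -> u v <- vE; apply: same.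
  case/andP=> /andP[/contract_edgeP[_ [s [t [sA tA' st]]]] nE] pP lB u v uE vE.
  have sE := block_of_mem sA; have tE := block_of_mem tA'.
  apply: connect_trans (same u s _) _; first by rewrite uE sE.
  apply: connect_trans (IHp A' pP lB t v tE vE).
  apply: connect1; rewrite /sedge /= /del_edge_rel st /=.
  apply: contra nE => /eqP /(@set2_inj G)[] [sx ty].
    by rewrite -sE -tE sx ty bx by_.
  by rewrite -sE -tE sx ty bx by_ setUC.
have [c [cc xc nc]] := nonbridge_on_cycle xy (lift _ _ con y x by_ bx).
have xO := mem_cycle_vertices cc xc.
have yc : y \in cycle_through x.
  have E := eq_mem_of_meet Gd cc (is_cycle_through xO) xc (mem_cycle_through xO).
  by rewrite -E -nc mem_next.
by apply: nB; rewrite -bx -by_; apply/esym/eqP; rewrite -block_of_through.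
Qed.

End Blocks.

(** * Matchings of a graph and of its contraction *)

Section InducedMatchings.
Variables (G : sgraph) (A : {set G}).

Lemma induced_pairing : exists (S : {set G}) mu,
  [/\ pairing S mu, S \subset A & #|S| = (2 * matching_number (induced A))%N].
Proof.
have [S0 [mu0 [pS0 cS0]]] := matching_number_pairing (induced A).
exists [set val x | x in S0], (fun x => if insub x is Some u then val (mu0 u) else x); split.
- move=> _ /imsetP[u uS ->]; rewrite valK; have [mS mm e] := pS0 u uS.
  by rewrite valK mm; split=> //; apply: imset_f.
- by apply/subsetP => _ /imsetP[u _ ->]; apply: valP.
- by rewrite card_imset //; apply: val_inj.
Qed.

Lemma induced_pairing_leq (S : {set G}) mu : pairing S mu -> S \subset A ->
  (#|S| <= 2 * matching_number (induced A))%N.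
Proof.
move=> pS /subsetP SA; pose S0 : {set induced A} := [set u | val u \in S].
have E (u : induced A) : u \in S0 -> val (insubd u (mu (val u)) : induced A) = mu (val u).
  by rewrite inE => uS; apply: insubdK; apply: SA; have [] := pS _ uS.
have pS0 : pairing S0 (fun u : induced A => insubd u (mu (val u))).
  move=> u uS0; have Eu := E u uS0; have uS : val u \in S by rewrite inE in uS0.
  have [mS mm e] := pS _ uS; have mS0 : (insubd u (mu (val u)) : induced A) \in S0.
    by rewrite inE Eu.
  split=> //; first by apply: val_inj; rewrite (E _ mS0) Eu mm.
  by rewrite /sedge /= /induced_edge Eu.
have -> : #|S| = #|S0|.
  rewrite -(card_imset (mem S0) val_inj); apply: eq_card => x.
  apply/idP/imsetP => [xS|[u]]; last by rewrite inE => uS ->.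
  by exists (exist _ x (SA x xS)) => //; rewrite inE.
exact: pairing_leq pS0.
Qed.

End InducedMatchings.

Section ContractionMatchings.
Variable G : sgraph.
Hypothesis Gd : cycles_disjoint G.
Let O := cycle_vertices G.
Let V := cycle_vsets G.
Let T := contract_cycles G.
Let thr := @cycle_through G.
Let blk := @block_of G.

Lemma even_through_card : (forall c : seq G, is_cycle c -> ~~ odd (size c)) ->
  (2 * #|[set x in O | ~~ odd_pos (thr x) x]| = #|O|)%N.
Proof.
move=> even; apply: card_flip (next_through_inj Gd) _ => x xO.
have xc := mem_cycle_through xO; have cc := is_cycle_through xO.
have nc : next (thr x) x \in thr x by rewrite mem_next.
split; first exact: mem_cycle_throughO nc.
by rewrite /thr (eq_cycle_through Gd xO nc) odd_pos_next // even.
Qed.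

(** The perfect matching of an even cycle by the positions 0-1, 2-3, and so on. *)
Definition mate x := if odd_pos (thr x) x then prev (thr x) x else next (thr x) x.

Lemma mateP x : (forall c : seq G, is_cycle c -> ~~ odd (size c)) -> x \in O ->
  [/\ mate x \in thr x, mate (mate x) = x & sedge x (mate x)].
Proof.
move=> even xO; have xc := mem_cycle_through xO; have cc := is_cycle_through xO.
have uc := is_cycle_uniq cc.
have mc : mate x \in thr x.
  by rewrite /mate; case: ifP => _; rewrite ?mem_prev ?mem_next.
split=> //.
  rewrite {1}/mate /thr (eq_cycle_through Gd xO mc) -/thr /mate -/thr.
  case xo: (odd_pos (thr x) x); first by rewrite odd_pos_prev ?even // xo /= next_prev.
  by rewrite odd_pos_next ?even // xo /= prev_next.
rewrite /mate; case: ifP => _; last exact: is_cycle_next.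
have pc : prev (thr x) x \in thr x by rewrite mem_prev.
by rewrite sedge_sym; have := is_cycle_next cc pc; rewrite next_prev.
Qed.

(** Every even cycle has a perfect matching, so those of the cycles can be joined
   to any matching outside them. *)
Lemma matching_number_outside : (forall c : seq G, is_cycle c -> ~~ odd (size c)) ->
  (2 * matching_number (induced (~: O)) + #|O| <= 2 * matching_number G)%N.
Proof.
move=> even; have [S [mu [pS SO <-]]] := induced_pairing (~: O).
have notO x : x \in S -> x \in O = false.
  by move=> /(subsetP SO); rewrite inE => /negPf.
have -> : (#|S| + #|O|)%N = #|S :|: O|.
  rewrite cardsU; suff -> : S :&: O = set0 by rewrite cards0 subn0.
  by apply/setP => x; rewrite !inE; case: (boolP (x \in S)) => // /notO.
apply: (@pairing_leq G _ (fun x => if x \in O then mate x else mu x)) => x.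
rewrite !inE; case: (boolP (x \in O)) => [xO _|xO]; last first.
  rewrite orbF => xS; have [mS mm e] := pS x xS.
  by rewrite notO // mS mm.
have [mc mm e] := mateP even xO; have mO := mem_cycle_throughO xO mc.
by rewrite mO orbT mm.
Qed.

(** A cover of the contraction meets every pair, in blocks that are different
   singletons. *)
Lemma cover_matching (XT : {set T}) (S : {set G}) mu :
  (forall A B : T, sedge A B -> (A \in XT) || (B \in XT)) ->
  pairing S mu -> S \subset ~: O ->
  (#|S| <= 2 * #|[set B in XT | val B \notin V]|)%N.
Proof.
move=> cov pS /subsetP SO; pose Y := [set x in S | blk x \in XT].
have leY : (#|Y| <= #|[set B in XT | val B \notin V]|)%N.
  have blk_inj : {in Y &, injective blk}.
    move=> x y; rewrite !inE => /andP[xS _] /andP[yS _] E.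
    apply/eqP/negPn/negP => xy; have /andP[xO _] := same_block_cycle Gd xy E.
    by have := SO x xS; rewrite inE xO.
  rewrite -(card_in_imset blk_inj); apply/subset_leq_card/subsetP => _ /imsetP[x + ->].
  by rewrite [in X in X -> _]in_set => /andP[/SO + bX]; rewrite in_setC in_set bX block_ofV.
have : (#|S| <= #|Y| + #|[set mu x | x in Y]|)%N.
  apply: leq_trans (leq_card_setU _ _); apply/subset_leq_card/subsetP => x xS.
  have [mS mm e] := pS x xS.
  have nB : blk x <> blk (mu x).
    have xmx : x != mu x by rewrite eq_sym (pairing_neq pS).
    move=> E; have /andP[xO _] := same_block_cycle Gd xmx E.
    by have := SO x xS; rewrite inE xO.
  rewrite !inE xS; have /orP[->//|mX] := cov _ _ (block_edge e nB).
  by apply/orP; right; apply/imsetP; exists (mu x); rewrite ?inE ?mS ?mm.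
move/leq_trans; apply; rewrite mul2n -addnn leq_add //.
exact: leq_trans (leq_imset_card mu Y) leY.
Qed.

Lemma konig_cover : exists XT : {set T},
  [/\ forall A B : T, sedge A B -> (A \in XT) || (B \in XT),
      (#|XT| <= matching_number T)%N &
      (matching_number (induced (~: O)) <= #|[set B in XT | val B \notin V]|)%N].
Proof.
have [XT [S [mu [cov _ pS leX]]]] := forest_konig (contract_acyclic Gd) [set: T].
have cov' (A B : T) : sedge A B -> (A \in XT) || (B \in XT) by apply: cov; rewrite inE.
exists XT; split=> //.
  by rewrite -(leq_pmul2l (isT : (0 < 2)%N)) (leq_trans leX) // (pairing_leq pS).
have [S0 [mu0 [pS0 S0O cS0]]] := induced_pairing (~: O).
by have := cover_matching cov' pS0 S0O; rewrite cS0 leq_mul2l.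
Qed.

Lemma konig_leq : (matching_number (induced (~: O)) <= matching_number T)%N.
Proof.
have [XT [_ h1 h2]] := konig_cover; apply: leq_trans h2 (leq_trans _ h1).
by apply/subset_leq_card/subsetP => B; rewrite inE => /andP[].
Qed.

(** The singleton blocks of the cover suffice to bound the matchings outside the
   cycles, so when both matching numbers agree no cycle block is left. *)
Lemma konig_cover_off_cycles :
  matching_number T = matching_number (induced (~: O)) ->
  exists X : {set G},
    [/\ X \subset ~: O, (#|X| <= matching_number T)%N &
      forall x y, sedge x y -> x \notin X -> y \notin X ->
        (x \in O) && (y \in thr x)].
Proof.
move=> mE; have [XT [cov h1 h2]] := konig_cover.
have XV B : B \in XT -> val B \notin V.
  move=> BX; apply/negP => BV; have : ([set B in XT | val B \notin V] \proper XT).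
    apply/properP; split; first by apply/subsetP => A; rewrite inE => /andP[].
    by exists B; rewrite // in_set BX BV.
  by move/proper_card; rewrite ltnNge (leq_trans h1) // mE.
pose X := [set x | blk x \in XT].
have XO x : x \in X -> x \notin O.
  by rewrite inE => /XV; rewrite /V /blk (block_ofV Gd).
exists X; split.
- by apply/subsetP => x /XO; rewrite inE.
- apply: leq_trans h1; have blk_inj : {in X &, injective blk}.
    move=> x y /XO xO _ E; apply/eqP/negPn/negP => xy.
    by have /andP[] := same_block_cycle Gd xy E; rewrite (negPf xO : x \in cycle_vertices G = false).
  rewrite -(card_in_imset blk_inj); apply/subset_leq_card/subsetP => _ /imsetP[x + ->].
  by rewrite inE.
move=> x y xy; rewrite !inE => xX yX; have [E|nE] := eqVneq (blk x) (blk y).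
  by apply: same_block_cycle E => //; apply: contraTneq xy => ->; rewrite sedge_irrefl.
by have := cov _ _ (block_edge xy (elimN eqP nE)); rewrite (negPf xX) (negPf yX).
Qed.

(** A matching of the contraction meets each cycle in at most one vertex; this
   vertex and its successor are left out of an otherwise perfect matching of the
   even cycle, and the successor keeps the result free of cycles. *)
Lemma lift_matching : (forall c : seq G, is_cycle c -> ~~ odd (size c)) ->
  exists (S : {set G}) mu,
    [/\ pairing S mu, forall c : seq G, is_cycle c -> exists2 x, x \in c & x \notin S &
        (2 * matching_number T + #|O| <= #|S| + 2 * #|V|)%N].
Proof.
move=> even; have [ST [muT [pST cST]]] := matching_number_pairing T.
have [att attB att_edge] : exists2 att : T -> G, forall B, att B \in val B &
    forall B, B \in ST -> sedge (att B) (att (muT B)).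
  have ends (A B : T) : exists p : G * G, sedge A B ==>
      [&& p.1 \in val A, p.2 \in val B & sedge p.1 p.2].
    have [/contract_edgeP[_ [x [y [xA yB xy]]]]|nAB] := boolP (sedge A B).
      by exists (x, y); rewrite xA yB xy implybT.
    by have [x _] := block_nonempty A; exists (x, x).
  pose p A B := xchoose (ends A B).
  have pP A B : sedge A B -> [&& (p A B).1 \in val A, (p A B).2 \in val B & sedge (p A B).1 (p A B).2].
    by move=> AB; apply: (implyP (xchooseP (ends A B))).
  pose r (B : T) : nat := enum_rank B.
  exists (fun B => if B \in ST then if (r B < r (muT B))%N then (p B (muT B)).1
                   else (p (muT B) B).2 else xchoose (block_nonempty B)) => B.
    case: ifP => [BS|_]; last exact: (xchooseP (block_nonempty B)).
    have [_ _ e] := pST B BS; case: ifP => _; first by case/and3P: (pP _ _ e).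
    by rewrite sedge_sym in e; case/and3P: (pP _ _ e).
  move=> BS; have [mS mm e] := pST B BS; rewrite BS mS mm.
  have rr : r B != r (muT B).
    by rewrite (inj_eq val_inj) (inj_eq enum_rank_inj) eq_sym (pairing_neq pST).
  have e' := e; rewrite sedge_sym in e'.
  case: ltngtP rr => // _ _; first by case/and3P: (pP _ _ e).
  by rewrite sedge_sym; case/and3P: (pP _ _ e').
have blk_att B : blk (att B) = B by apply: block_of_mem; rewrite ?attB.
pose root x := att (blk x).
have root_thr x : x \in O -> root x \in thr x.
  by move=> xO; rewrite block_of_through //; apply/eqP/blk_att.
have blk_thr x y : x \in O -> y \in thr x -> blk y = blk x.
  by move=> xO; rewrite block_of_through // => /eqP.
pose odd_from x := odd_pos (thr x) x != odd_pos (thr x) (root x).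
pose mu x := if x == root x then att (muT (blk x))
             else if odd_from x then prev (thr x) x else next (thr x) x.
pose S := [set x | if x == root x then blk x \in ST
                   else (x \in O) && (x != next (thr x) (root x))].
have same x y : x \in O -> y \in thr x ->
    [/\ y \in O, thr y = thr x & root y = root x].
  move=> xO yx; split; first exact: mem_cycle_throughO yx.
    exact: eq_cycle_through.
  by rewrite /root (blk_thr _ _ xO yx).
have pS : pairing S mu.
  move=> x; rewrite in_set /mu; case: (eqVneq x (root x)) => [xr BS|xr /andP[xO xn]].
    have [mS mm e] := pST _ BS; have ed := att_edge _ BS.
    by rewrite in_set /root blk_att eqxx mS mm -/(root x) -xr; split=> //; rewrite {1}xr.
  have cc := is_cycle_through xO; have uc := is_cycle_uniq cc.
  have ec := even _ cc; have xc := mem_cycle_through xO; have rc := root_thr x xO.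
  have nc : next (thr x) x \in thr x by rewrite mem_next.
  have pc : prev (thr x) x \in thr x by rewrite mem_prev.
  case of_: (odd_from x).
    have [yO yt yr] := same x _ xO pc.
    have nyr : prev (thr x) x != root x.
      by apply: contraNneq xn => <-; rewrite next_prev.
    have oy : odd_from (prev (thr x) x) = false.
      rewrite /odd_from yt yr odd_pos_prev //; move: of_; rewrite /odd_from.
      by case: (odd_pos _ x); case: (odd_pos _ _).
    rewrite in_set yr yt (negPf nyr) yO oy next_prev //; split=> //.
      apply: contraTneq of_ => E; move: oy; rewrite /odd_from yt yr E odd_pos_next //.
      by case: (odd_pos _ _).
    by have := is_cycle_next cc pc; rewrite sedge_sym next_prev.
  have [yO yt yr] := same x _ xO nc.
  have oy : odd_from (next (thr x) x).
    rewrite /odd_from yt yr odd_pos_next //; move: of_; rewrite /odd_from.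
    by case: (odd_pos _ x); case: (odd_pos _ _).
  have nyr : next (thr x) x != root x.
    by apply: contraTneq oy => E; rewrite /odd_from yt yr E eqxx.
  rewrite in_set yr yt (negPf nyr) yO oy prev_next //; split=> //.
    by rewrite (inj_eq (can_inj (prev_next uc))).
  exact: is_cycle_next.
exists S, mu; split=> //.
  move=> c cc; have [x xc] : exists x, x \in c by exact: cycle_inhabited.
  have xO := mem_cycle_vertices cc xc; have rc := root_thr x xO.
  have nc : next (thr x) (root x) \in thr x by rewrite mem_next.
  have [yO yt yr] := same x _ xO nc.
  exists (next (thr x) (root x)).
    by rewrite (eq_mem_of_meet Gd cc (is_cycle_through xO) xc (mem_cycle_through xO)).
  rewrite in_set yr yt eqxx andbF ifN //.
  exact: is_cycle_next_neq (is_cycle_through xO) rc.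
rewrite -cST; pose VT := [set B : T | val B \in V].
have leVT : (#|VT| <= #|V|)%N.
  rewrite -(card_imset (mem VT) val_inj); apply/subset_leq_card/subsetP => _ /imsetP[B + ->].
  by rewrite in_set.
have att_inj : injective att by apply: can_inj blk_att.
pose R1 := att @: VT; pose R2 := [set next (thr (att B)) (att B) | B in VT].
have sub1 : O \subset (S :\: (att @: ST)) :|: (R1 :|: R2).
  apply/subsetP => x xO; rewrite !in_setU.
  have BV : blk x \in VT by rewrite in_set /V /blk block_of_O.
  case: (eqVneq x (root x)) => [xr|xr].
    by apply/orP; right; apply/orP; left; rewrite xr; apply: imset_f.
  case: (eqVneq x (next (thr x) (root x))) => [xn|xn].
    apply/orP; right; apply/orP; right; apply/imsetP; exists (blk x) => //.
    have [_ yt _] := same x _ xO (root_thr x xO).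
    by rewrite -/(root x) yt.
  apply/orP; left; rewrite in_setD in_set (negPf xr) xO xn !andbT.
  apply: contra xr => /imsetP[B _ xB].
  by rewrite /root xB blk_att.
have sub2 : att @: ST \subset S.
  by apply/subsetP => _ /imsetP[B BS ->]; rewrite in_set /root blk_att eqxx.
have := subset_leq_card sub1; have := cardsID (att @: ST) S.
rewrite (setIidPr sub2) card_imset //.
have h1 := leq_card_setU (S :\: (att @: ST)) (R1 :|: R2).
have h2 := leq_card_setU R1 R2.
have h3 : (#|R1| <= #|V|)%N := leq_trans (leq_imset_card _ _) leVT.
have h4 : (#|R2| <= #|V|)%N := leq_trans (leq_imset_card _ _) leVT.
move=> <- h5; rewrite -addnA leq_add2l (leq_trans h5) // (leq_trans h1) //.
by rewrite leq_add2l (leq_trans h2) // mul2n -addnn leq_add.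
Qed.

End ContractionMatchings.

Local Open Scope ring_scope.
Local Open Scope sesquilinear_scope.

(** * Hermitian forms and their inertia *)

Lemma char_poly_conj (F : fieldType) n (P A : 'M[F]_n) : P \in unitmx ->
  char_poly (invmx P *m A *m P) = char_poly A.
Proof.
move=> uP; rewrite /char_poly /char_poly_mx.
pose Q : 'M[{poly F}]_n := map_mx polyC P.
pose Q' : 'M[{poly F}]_n := map_mx polyC (invmx P).
have QQ : Q' *m Q = 1%:M by rewrite -map_mxM mulVmx // map_mx1.
have -> : 'X%:M - map_mx polyC (invmx P *m A *m P) =
          Q' *m ('X%:M - map_mx polyC A) *m Q.
  rewrite mulmxBr mulmxBl scalar_mxC -['X%:M *m _ *m _]mulmxA QQ mulmx1.
  by rewrite !map_mxM.
by rewrite !det_mulmx mulrAC -det_mulmx QQ det1 mul1r.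
Qed.

Lemma hermitian_diagonalization (C : numClosedFieldType) n (A : 'M[C]_n) :
  A ^t* = A ->
  exists (P : 'M[C]_n) (D : 'rV[C]_n),
    [/\ P \in unitmx, A = P ^t* *m diag_mx D *m P, forall j, D 0 j \is Num.real &
        perm_eq (eigenvalues A) [seq D 0 j | j <- enum 'I_n]].
Proof.
move=> hA.
have hermA : A \is hermsymmx.
  by apply/is_hermitianmxP; rewrite expr0 scale1r hA.
have AE := orthomx_spectralP (hermitian_normalmx hermA).
have Pu := spectral_unitarymx A.
exists (spectralmx A), (spectral_diag A); split.
- exact: spectral_unit.
- by rewrite -invmx_unitary.
- by move=> j; apply: (mxOverP (hermitian_spectral_diag_real hermA)).
apply: prod_XsubC_eq.
rewrite /eigenvalues; case: closed_field_poly_normal => r /=.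
rewrite (monicP (char_poly_monic A)) scale1r => <-.
rewrite {1}AE char_poly_conj ?spectral_unit // char_poly_trig; last first.
  exact: diag_mx_is_trig.
rewrite big_map big_enum /=; apply: eq_bigr => j _.
by rewrite mxE eqxx mulr1n.
Qed.

Section HermitianForm.
Variables (C : numClosedFieldType) (T : finType) (a : T -> T -> C).

Definition hform (f g : T -> C) : C := \sum_x \sum_y f x * a x y * (g y)^*.

Definition comb (I : finType) (b : I -> C) (F : I -> T -> C) (x : T) : C :=
  \sum_i b i * F i x.

Definition negative_definite (I : finType) (F : I -> T -> C) :=
  forall b : I -> C, (exists i, b i != 0) -> hform (comb b F) (comb b F) < 0.

Definition totally_isotropic (I : finType) (F : I -> T -> C) :=
  forall i j, hform (F i) (F j) = 0.

Definition independent (I : finType) (F : I -> T -> C) :=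
  forall b : I -> C, (forall x, comb b F x = 0) -> forall i, b i = 0.

Lemma hformDl f1 f2 g :
  hform (fun x => f1 x + f2 x) g = hform f1 g + hform f2 g.
Proof.
rewrite /hform -big_split; apply: eq_bigr => x _ /=.
by rewrite -big_split; apply: eq_bigr => y _ /=; rewrite !mulrDl.
Qed.

Lemma hformDr f g1 g2 :
  hform f (fun x => g1 x + g2 x) = hform f g1 + hform f g2.
Proof.
rewrite /hform -big_split; apply: eq_bigr => x _ /=.
by rewrite -big_split; apply: eq_bigr => y _ /=; rewrite rmorphD mulrDr.
Qed.

Lemma hformZl k f g : hform (fun x => k * f x) g = k * hform f g.
Proof.
rewrite /hform big_distrr; apply: eq_bigr => x _ /=.
by rewrite big_distrr; apply: eq_bigr => y _ /=; rewrite !mulrA.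
Qed.

Lemma hformZr k f g : hform f (fun x => k * g x) = k^* * hform f g.
Proof.
rewrite /hform big_distrr; apply: eq_bigr => x _ /=.
rewrite big_distrr; apply: eq_bigr => y _ /=.
by rewrite rmorphM [RHS]mulrCA.
Qed.

Lemma eq_hform f1 f2 g1 g2 : f1 =1 f2 -> g1 =1 g2 -> hform f1 g1 = hform f2 g2.
Proof.
move=> ef eg; apply: eq_bigr => x _; apply: eq_bigr => y _.
by rewrite ef eg.
Qed.

Lemma hform_suml (I : finType) (b : I -> C) F g :
  hform (comb b F) g = \sum_i b i * hform (F i) g.
Proof.
rewrite /hform /comb.
under [RHS]eq_bigr do rewrite big_distrr.
rewrite [RHS]exchange_big; apply: eq_bigr => x _ /=.
under [RHS]eq_bigr do rewrite big_distrr.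
rewrite [RHS]exchange_big; apply: eq_bigr => y _ /=.
by rewrite !big_distrl; apply: eq_bigr => i _ /=; rewrite !mulrA.
Qed.

Hypothesis a_herm : forall x y, a y x = (a x y)^*.

Lemma hform_conj f g : (hform f g)^* = hform g f.
Proof.
rewrite /hform rmorph_sum [RHS]exchange_big; apply: eq_bigr => x _.
rewrite rmorph_sum; apply: eq_bigr => y _.
rewrite !rmorphM /= conjCK -a_herm.
by rewrite mulrC mulrA mulrAC.
Qed.

End HermitianForm.

Lemma ex_null_combination (F : fieldType) (I J : finType) (K : I -> J -> F) :
  (#|J| < #|I|)%N ->
  exists b : I -> F, (exists i, b i != 0) /\ forall j, \sum_i b i * K i j = 0.
Proof.
move=> ltJI.
pose M : 'M[F]_(#|I|, #|J|) := \matrix_(i, j) K (enum_val i) (enum_val j).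
have /rowV0Pn[u /sub_kermxP uM /rV0Pn[i ui]] : kermx M != 0.
  rewrite -mxrank_eq0 mxrank_ker -lt0n subn_gt0.
  exact: leq_ltn_trans (rank_leq_col M) ltJI.
exists (fun i => u 0 (enum_rank i)); split.
  by exists (enum_val i); rewrite enum_valK.
move=> j; transitivity ((u *m M) 0 (enum_rank j)); last by rewrite uM mxE.
rewrite mxE [RHS](reindex (@enum_rank I)) /=; last first.
  exact/onW_bij/enum_rank_bij.
by apply: eq_bigr => k _; rewrite mxE !enum_rankK.
Qed.

Section Inertia.
Variables (C : numClosedFieldType) (T : finType) (a : T -> T -> C).
Hypothesis a_herm : forall x y, a y x = (a x y)^*.

Let A : 'M[C]_#|T| := \matrix_(i, j) a (enum_val i) (enum_val j).
Let neg := count (fun z => z < 0) (eigenvalues A).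

(** The values [l j f] are the coordinates of [f] in an orthonormal basis of
   eigenvectors. *)
Lemma hform_diagonalization :
  exists (d : 'I_#|T| -> C) (L : 'I_#|T| -> T -> C),
    let l j f := \sum_x f x * L j x in
    [/\ forall f, hform a f f = \sum_j d j * `|l j f| ^+ 2,
        forall f, (forall j, l j f = 0) -> forall x, f x = 0,
        forall j, d j \is Num.real &
        neg = #|[pred j | d j < 0]|].
Proof.
have hA : A ^t* = A.
  by apply/matrixP=> i j; rewrite !mxE -a_herm.
have [P [D [uP AE Dr pD]]] := hermitian_diagonalization hA.
exists (fun j => D 0 j), (fun j x => (P j (enum_rank x))^*).
have e_bij : {on predT, bijective (@enum_rank T)} by apply/onW_bij/enum_rank_bij.
split=> //.
- move=> f.
  transitivity (\sum_x \sum_y \sum_j D 0 j *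
     ((f x * (P j (enum_rank x))^*) * (f y * (P j (enum_rank y))^*)^*)).
    apply: eq_bigr => x _; apply: eq_bigr => y _.
    have -> : a x y = A (enum_rank x) (enum_rank y) by rewrite mxE !enum_rankK.
    rewrite AE mul_mx_diag mxE mulr_sumr mulr_suml; apply: eq_bigr => j _.
    rewrite !mxE rmorphM /= conjCK.
    by rewrite ![_ * D 0 j]mulrC !mulrA [f x * _]mulrC -!mulrA (mulrC (f y)^*).
  rewrite exchange_big /=; under eq_bigr do rewrite exchange_big /=.
  rewrite exchange_big /=; apply: eq_bigr => j _.
  rewrite normCK rmorph_sum mulr_suml mulr_sumr exchange_big /=.
  apply: eq_bigr => x _; rewrite !mulr_sumr.
  by apply: eq_bigr => y _.
- move=> f lf x.
  pose u : 'rV[C]_#|T| := \row_i f (enum_val i).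
  suff: u = 0 by move/(congr1 (fun N : 'rV_#|T| => N 0 (enum_rank x))); rewrite !mxE enum_rankK.
  have uPt : P ^t* \in unitmx by rewrite map_unitmx unitmx_tr.
  rewrite -[u](mulmxK uPt); have -> : u *m P ^t* = 0; last by rewrite mul0mx.
  apply/rowP=> j; rewrite !mxE -[RHS](lf j) (reindex _ e_bij) /=.
  by apply: eq_bigr => k _; rewrite !mxE enum_rankK.
rewrite /neg (permP pD) count_map [RHS]cardE.
rewrite -size_filter /enum_mem -filter_predI.
by congr size; apply: eq_filter => j; rewrite !inE /= andbT.
Qed.

(** If the family were larger, a nonzero combination would have no component along
   the negative eigenvectors, and the form would be nonnegative on it. *)
Lemma negative_definite_leq (I : finType) (F : I -> T -> C) :
  negative_definite a F -> (#|I| <= neg)%N.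
Proof.
have [d [L [hE _ dr ->]]] := hform_diagonalization => negF.
rewrite leqNgt; apply/negP => ltI.
pose J : finType := {j | d j < 0}.
have [|b [bn0 bK]] := @ex_null_combination C I J
  (fun i j => \sum_x F i x * L (val j) x); first by rewrite card_sig.
have := negF b bn0; rewrite hE le_gtF //; apply: sumr_ge0 => j _.
have [dj|] := boolP (d j < 0); last first.
  by rewrite -real_leNgt ?real0 // => dj; rewrite mulr_ge0 ?exprn_ge0.
suff -> : \sum_x comb b F x * L j x = 0 by rewrite normr0 expr0n mulr0.
rewrite -[RHS](bK (exist _ j dj)) /=.
under eq_bigr do rewrite mulr_suml.
rewrite exchange_big; apply: eq_bigr => i _ /=.
by rewrite mulr_sumr; apply: eq_bigr => x _; rewrite mulrA.
Qed.

(** If the family were larger, a nonzero combination would have no component along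
   the nonnegative eigenvectors, and the form would be negative on it. *)
Lemma totally_isotropic_leq (I : finType) (F : I -> T -> C) :
  totally_isotropic a F -> independent F -> (#|I| + neg <= #|T|)%N.
Proof.
have [d [L [hE l0 dr ->]]] := hform_diagonalization => isoF indF.
rewrite leqNgt; apply/negP => ltI.
pose J : finType := {j | ~~ (d j < 0)}.
have cJ : (#|J| < #|I|)%N.
  rewrite card_sig -(ltn_add2r #|[pred j | d j < 0]|) addnC.
  by rewrite cardC card_ord.
have [b [[i bi] bK]] := @ex_null_combination C I J
  (fun i j => \sum_x F i x * L (val j) x) cJ.
have lE j : \sum_x comb b F x * L j x = \sum_i b i * \sum_x F i x * L j x.
  under eq_bigr do rewrite mulr_suml.
  rewrite exchange_big; apply: eq_bigr => k _ /=.
  by rewrite mulr_sumr; apply: eq_bigr => x _; rewrite mulrA.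
have h0 : hform a (comb b F) (comb b F) = 0.
  rewrite hform_suml big1 // => k _; rewrite -hform_conj // hform_suml.
  by rewrite big1 ?rmorph0 ?mulr0 // => k' _; rewrite isoF mulr0.
suff /indF/(_ i) bi0 : forall x, comb b F x = 0 by rewrite bi0 eqxx in bi.
apply: l0 => j; have [dj|dj] := boolP (d j < 0); last first.
  by rewrite lE; apply: (bK (exist _ j dj)).
have t0 k : 0 <= - (d k * `|\sum_x comb b F x * L k x| ^+ 2).
  have [dk|dk] := boolP (d k < 0).
    by rewrite -mulNr mulr_ge0 ?exprn_ge0 ?oppr_ge0 // ltW.
  by rewrite lE (bK (exist _ k dk)) normr0 expr0n mulr0 oppr0.
have /eqP := h0; rewrite hE -oppr_eq0 -sumrN psumr_eq0 // => /allP/(_ j).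
rewrite mem_index_enum oppr_eq0 mulf_eq0 (lt_eqF dj) /= expf_eq0 /= normr_eq0.
by move/(_ isT)/eqP.
Qed.

End Inertia.

(** * Null vectors of a cycle *)

Section Gains.
Variables (C : numClosedFieldType) (G : sgraph) (phi : unit_gain C G).

Definition weight (x y : G) : C := if sedge x y then phi x y else 0.

Lemma weight_herm x y : weight y x = (weight x y)^*.
Proof.
rewrite /weight sedge_sym; case: ifP => [xy|_]; last by rewrite rmorph0.
have yx : sedge y x by rewrite sedge_sym.
by rewrite (gain_inv phi yx) invC_norm (gain_norm phi xy) expr1n invr1 mul1r.
Qed.

Lemma weight0 x y : ~~ sedge x y -> weight x y = 0.
Proof. by rewrite /weight => /negPf ->. Qed.

Lemma weightV x y : sedge x y -> weight x y * weight y x = 1.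
Proof.
move=> xy; have n1 := gain_norm phi xy.
by rewrite (weight_herm x y) -normCK /weight xy n1 expr1n.
Qed.

Lemma weight_neq0 x y : sedge x y -> weight x y != 0.
Proof.
move=> xy; apply: contraTneq isT => w0; have := weightV xy.
by rewrite w0 mul0r => /esym/eqP; rewrite oner_eq0.
Qed.

End Gains.

Definition delta (C : numClosedFieldType) (T : finType) (u : T) : T -> C :=
  fun x => (x == u)%:R.

Section Delta.
Variables (C : numClosedFieldType) (T : finType) (a : T -> T -> C).

Lemma sum_delta (f : T -> C) u : \sum_x f x * delta C u x = f u.
Proof.
rewrite (bigD1 u) //= big1 ?addr0 /delta ?eqxx ?mulr1 // => x /negPf ->.
by rewrite mulr0.
Qed.

Lemma hform_deltar f u : hform a f (delta C u) = \sum_x f x * a x u.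
Proof.
apply: eq_bigr => x _; rewrite -[RHS](sum_delta (fun y => f x * a x y)).
by apply: eq_bigr => y _; rewrite /delta rmorph_nat.
Qed.

Lemma hform_delta u v : hform a (delta C u) (delta C v) = a u v.
Proof.
rewrite hform_deltar -[RHS](sum_delta (a^~ v)).
by apply: eq_bigr => x _; rewrite mulrC.
Qed.

End Delta.

Section CycleForms.
Variables (C : numClosedFieldType) (G : sgraph) (phi : unit_gain C G).
Hypothesis Gd : cycles_disjoint G.
Variable c : seq G.
Hypothesis cc : is_cycle c.
Let w := weight phi.

Lemma sum_weight_cycle (f : G -> C) y : y \in c -> (forall x, x \notin c -> f x = 0) ->
  \sum_x f x * w x y = f (prev c y) * w (prev c y) y + f (next c y) * w (next c y) y.
Proof.
move=> yc f0.
have uc := is_cycle_uniq cc.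
have pn : next c y != prev c y.
  apply: contraNneq (is_cycle_next2_neq cc yc) => ->.
  by rewrite next_prev.
rewrite (bigD1 (prev c y)) //= (bigD1 (next c y)) //= big1 ?addr0 //.
move=> x /andP[xp xn]; have [xc|/f0 ->] := boolP (x \in c); last by rewrite mul0r.
rewrite /w weight0 ?mulr0 //; apply/negP => xy.
case/orP: (cycle_chordless Gd cc xc yc xy) => /eqP E; last by rewrite E eqxx in xn.
by rewrite E prev_next ?eqxx in xp.
Qed.

Definition gain_upto x0 j : C :=
  \prod_(t < j) phi (walk c x0 t) (walk c x0 t.+1).

Lemma gain_upto0 x0 : gain_upto x0 0 = 1.
Proof. exact: big_ord0. Qed.

Lemma gain_uptoS x0 j :
  gain_upto x0 j.+1 = gain_upto x0 j * phi (walk c x0 j) (walk c x0 j.+1).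
Proof. exact: big_ord_recr. Qed.

Lemma gain_upto_neq0 x0 j : gain_upto x0 j != 0.
Proof.
apply/prodf_neq0 => t _; have e := walk_edge cc x0 t.
by have := weight_neq0 phi e; rewrite /weight e.
Qed.

Lemma gain_upto_size x0 : gain_upto x0 (size c) = cycle_gain phi c.
Proof.
rewrite /cycle_gain (big_nth x0) big_mkord; apply: eq_bigr => j _.
by rewrite walkS (walk_nth cc).
Qed.

Hypothesis even_size : ~~ odd (size c).

Lemma weight_same_parity x y : x \in c -> y \in c -> odd_pos c x = odd_pos c y ->
  w x y = 0.
Proof.
move=> xc yc E; apply: weight0; apply/negP => /(cycle_chordless Gd cc xc yc).
case/orP=> /eqP E'; move: E; rewrite E' odd_pos_next //; by case: (odd_pos _ _).
Qed.

(** Around the cycle, the equations for a null vector supported on one parity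
   class determine the next value from the previous one; the factor picked up
   in one turn is 1 exactly when the cycle is of Type A. *)
Lemma type_A_null_vector : type_A phi c ->
  exists z : G -> C, (forall x, (z x != 0) = (x \in c) && odd_pos c x) /\
    (forall y, y \in c -> ~~ odd_pos c y -> \sum_x z x * w x y = 0).
Proof.
move=> [_ tA]; have [x0 _] := cycle_inhabited cc.
(* the powers of 'i make the two neighbours of a vertex contribute opposite amounts *)
pose y x : C := 'i ^+ index x c * gain_upto x0 (index x c).
have i0 : 'i != 0 :> C by rewrite neq0Ci.
have yS x : x \in c -> y (next c x) = 'i * y x * w x (next c x).
  move=> xc; rewrite /w /weight is_cycle_next //.
  have nE : next c x = walk c x0 (index x c).+1 by rewrite walkS walk_index.
  suff -> : y (next c x) = 'i ^+ (index x c).+1 * gain_upto x0 (index x c).+1.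
    by rewrite exprS gain_uptoS -nE walk_index // /y !mulrA.
  rewrite /y index_next //; case: eqP => // E.
  (* closing the turn: the accumulated factor is ('i ^ 2 * -1) ^ (size c / 2) = 1 *)
  rewrite E gain_upto_size tA -{1}[size c](odd_double_half) (negPf even_size) add0n.
  by rewrite -mul2n exprM sqrCi -exprMn mulrNN mulr1 expr1n expr0 mul1r gain_upto0.
have y0 x : y x != 0 by rewrite mulf_neq0 ?gain_upto_neq0 // expf_neq0.
move: y y0 yS => y y0 yS.
pose z x := if (x \in c) && odd_pos c x then y x else 0.
exists z; split=> [x|x xc xe].
  by rewrite /z; case: ifP => _; rewrite ?eqxx ?y0.
have uc := is_cycle_uniq cc.
rewrite sum_weight_cycle //; last by move=> u /negPf uc'; rewrite /z uc'.
rewrite /z mem_prev mem_next xc odd_pos_prev // odd_pos_next // xe /=.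
have /= := yS (prev c x); rewrite mem_prev next_prev // => /(_ xc) yx.
rewrite yS // -!mulrA weightV ?is_cycle_next // mulr1.
by rewrite yx !mulrA -expr2 sqrCi mulN1r mulNr subrr.
Qed.

(** One turn of the same recursion would multiply a nonzero value by a factor
   different from 1. *)
Lemma non_type_A_injective (f : G -> C) : ~ type_A phi c ->
  (forall x, f x != 0 -> (x \in c) && ~~ odd_pos c x) ->
  (forall y, y \in c -> odd_pos c y -> \sum_x f x * w x y = 0) ->
  forall x, f x = 0.
Proof.
move=> nA fsupp f_null x.
have uc := is_cycle_uniq cc.
have fS y : y \in c -> ~~ odd_pos c y ->
    f (next c (next c y)) = - (f y * (w y (next c y) * w (next c y) (next c (next c y)))).
  move=> yc ye; have := f_null (next c y); rewrite mem_next odd_pos_next // yc ye.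
  move=> /(_ isT isT); rewrite sum_weight_cycle ?mem_next //; last first.
    by move=> u; apply: contraNeq => /fsupp/andP[].
  rewrite prev_next // => E; set y1 := next c y; set y2 := next c y1.
  have e12 : sedge y2 y1 by rewrite sedge_sym is_cycle_next ?mem_next.
  move/eqP: E; rewrite addr_eq0 => /eqP E.
  by rewrite mulrA E mulNr opprK -mulrA (weightV phi e12) mulr1.
apply/eqP/negPn/negP => fx; apply: nA; split=> //.
have /andP[xc xe] := fsupp x fx.
pose v := walk c x; have vc := mem_walk cc x.
have fv j : f (v j.*2) = (-1) ^+ j * gain_upto x j.*2 * f (v 0%N).
  elim: j => [|j IHj]; first by rewrite gain_upto0 expr0 !mul1r.
  rewrite doubleS; have := fS (v j.*2) (vc _).
  rewrite odd_pos_walk // odd_double => /(_ isT); rewrite -!walkS => ->.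
  rewrite IHj !gain_uptoS /w /weight !walk_edge // exprS; ring.
have f0 : f (v 0%N) != 0.
  apply: contraNneq fx => f0.
  have := fv (index x c)./2; rewrite f0 mulr0 => <-.
  have := odd_double_half (index x c); rewrite -/(odd_pos c x) (negPf xe) add0n => ->.
  by rewrite /v walk_index.
have sE : (size c)./2.*2 = size c.
  by rewrite -[RHS]odd_double_half (negPf even_size).
have := fv (size c)./2; rewrite sE /v walk_size // -/v => /esym E.
have : (-1) ^+ (size c)./2 * gain_upto x (size c) = 1 by apply: (mulIf f0); rewrite mul1r.
move/(congr1 (fun t => (-1) ^+ (size c)./2 * t)).
by rewrite mulrA -exprMn mulrNN !mulr1 expr1n mul1r gain_upto_size.
Qed.

End CycleForms.

(** * Negative definite families on matched sets *)

Section NegativeOn.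
Variables (C : numClosedFieldType) (G : sgraph) (phi : unit_gain C G).
Let w := weight phi.

Definition negative_on (S : {set G}) (k : nat) :=
  exists (I : finType) (F : I -> G -> C),
    [/\ #|I| = k, forall i x, x \notin S -> F i x = 0 & negative_definite w F].

Lemma negative_on_leq S k : negative_on S k -> (k <= negative_inertia phi)%N.
Proof.
move=> [I [F [<- _]]]; exact: (negative_definite_leq (@weight_herm _ _ phi)).
Qed.

Lemma negative_on_set0 : negative_on set0 0.
Proof.
exists 'I_0, (fun _ _ => 0); split=> //; first by rewrite card_ord.
by move=> b [[]].
Qed.

(** If [h] has no neighbour in [S], the plane spanned by [h] and a neighbour [y]
   is hyperbolic, and correcting the vectors on [S] along [h] makes them
   orthogonal to it; a negative vector of that plane then adds one dimension. *)
Lemma negative_on_pendant (S : {set G}) (h y : G) k :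
  h \notin S -> y \notin S -> sedge h y -> {in S, forall z, ~~ sedge h z} ->
  negative_on S k -> negative_on (h |: (y |: S)) k.+1.
Proof.
move=> hS yS hy hz [I [F [cI F0 Fneg]]].
pose t i := - (\sum_z F i z * w z y) * w y h.
pose F' (j : I + unit) : G -> C :=
  match j with
  | inl i => fun x => F i x + t i * delta C h x
  | inr _ => fun x => delta C y x - w y h / 2%:R * delta C h x
  end.
have hy0 : h != y by apply: contraTneq hy => ->; rewrite sedge_irrefl.
exists (I + unit)%type, F'; split.
- by rewrite card_sum card_unit cI addn1.
- move=> [i|u] x; rewrite !inE !negb_or => /and3P[xh xy xS]; rewrite /= /delta.
    by rewrite F0 // (negPf xh) mulr0 addr0.
  by rewrite (negPf xh) (negPf xy) mulr0 subr0.
move=> b [j bj].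
pose f := comb (fun i => b (inl i)) F.
pose m := \sum_z f z * w z y.
pose be := b (inr tt).
pose s := - m * w y h - be * (w y h / 2%:R).
have f0 x : x \notin S -> f x = 0.
  by move=> xS; rewrite /f /comb big1 // => i _; rewrite F0 // mulr0.
have gE : comb b F' =1 (fun x => f x + (s * delta C h x + be * delta C y x)).
  move=> x; rewrite /comb big_sumType /= (big_pred1 tt); last by case.
  have -> : \sum_i b (inl i) * (F i x + t i * delta C h x) =
            f x - m * w y h * delta C h x.
    under eq_bigr do rewrite mulrDr.
    rewrite big_split /= -/(f x); congr (_ + _).
    rewrite -mulNr -mulNr /m; under eq_bigr do rewrite mulrA.
    rewrite -mulr_suml; congr (_ * _); rewrite /t.
    under eq_bigr do rewrite mulrA.
    rewrite -mulr_suml; congr (_ * _).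
    under eq_bigr do rewrite mulrN.
    rewrite sumrN; congr (- _).
    under eq_bigr do rewrite mulr_sumr.
    rewrite exchange_big; apply: eq_bigr => z _ /=.
    by rewrite mulr_suml; apply: eq_bigr => i _; rewrite mulrA.
  rewrite -/be /s; ring.
have fh : hform w f (delta C h) = 0.
  rewrite hform_deltar big1 // => z _; have [zS|/f0 ->] := boolP (z \in S).
    by rewrite /w weight0 ?mulr0 // sedge_sym hz.
  by rewrite mul0r.
have fy : hform w f (delta C y) = m by rewrite hform_deltar.
have herm := @hform_conj _ _ _ (@weight_herm _ _ phi).
have loop u : w u u = 0 by apply: weight0; rewrite sedge_irrefl.
have yh : sedge y h by rewrite sedge_sym.
have wV : w y h * w h y = 1 := weightV phi yh.
have hE : hform w (comb b F') (comb b F') = hform w f f - `|be| ^+ 2.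
  rewrite (eq_hform w gE gE) !hformDl !hformDr !hformZl !hformZr.
  rewrite -[hform w (delta C h) f]herm -[hform w (delta C y) f]herm fh fy.
  rewrite !hform_delta !loop conjC0 !(mulr0, addr0, add0r).
  have X : be^* * m + s * (be^* * w h y) = - (`|be| ^+ 2 / 2%:R).
    rewrite normCK /s; transitivity (be^* * m - m * be^* * (w y h * w h y)
       - be * be^* * (w y h * w h y) / 2%:R); first by field.
    by rewrite wV; field.
  have Y : be * m^* + be * (s^* * w y h) = - (`|be| ^+ 2 / 2%:R).
    have := congr1 Num.conj X.
    rewrite rmorphD !rmorphM /= conjCK -(weight_herm phi h y) => E.
    transitivity (be * m^* + s^* * (be * w y h)); first by ring.
    rewrite E rmorphN; congr (- _); apply: conj_Creal.
    by rewrite realM ?realX ?normr_real ?realV ?realn.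
  transitivity (hform w f f + (be^* * m + s * (be^* * w h y))
                + (be * m^* + be * (s^* * w y h))); first by ring.
  by rewrite X Y; field.
rewrite hE; have [fb|nfb] := boolP [exists i, b (inl i) != 0].
  have [i bi] := existsP fb.
  have := Fneg (fun i => b (inl i)) (ex_intro _ i bi).
  by move=> neg; rewrite ltr_wnDr // oppr_le0 exprn_ge0.
have b0 i : b (inl i) = 0 by apply/eqP/negPn; apply: contra nfb => bi; apply/existsP; exists i.
have -> : hform w f f = 0.
  rewrite /hform big1 // => x _; rewrite big1 // => z _.
  by rewrite {1}/f /comb big1 ?mul0r // => i _; rewrite b0 mul0r.
case: j bj => [i|[]] bj; first by rewrite b0 eqxx in bj.
by rewrite sub0r oppr_lt0 exprn_gt0 // normr_gt0.
Qed.

End NegativeOn.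

Section LowerBounds.
Variables (C : numClosedFieldType) (G : sgraph) (phi : unit_gain C G).
Let w := weight phi.

(** The form pairs even with odd positions through an injective matrix B, so that
   its value on f - fB, for f supported on the even positions, is - 2 |fB|^2. *)
Lemma negative_on_non_type_A (c : seq G) : cycles_disjoint G -> is_cycle c ->
  ~~ odd (size c) -> ~ type_A phi c -> negative_on phi [set x in c] (size c)./2.
Proof.
move=> Gd cc ec nA.
pose E := [set x in c | ~~ odd_pos c x].
have sub_c x : x \notin [set x in c] -> x \in c = false by rewrite inE => /negPf.
exists {x | x \in E}, (fun i x => delta C (val i) x -
  if (x \in c) && odd_pos c x then w (val i) x else 0); split.
- by have := card_even_pos cc ec; rewrite card_sig; set n := #|_|; rewrite -/E; lia.
- move=> [i iE] x /= /sub_c xc; rewrite xc /= subr0 /delta.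
  by case: eqP => // xi; move: iE; rewrite -xi inE xc.
move=> b [[i0 i0E] bi0].
pose f x : C := \sum_(i : {x | x \in E}) b i * delta C (val i) x.
pose g x : C := if (x \in c) && odd_pos c x then - (\sum_u f u * w u x) else 0.
have fi (i : {x | x \in E}) : f (val i) = b i.
  rewrite /f (bigD1 i) //= big1 ?addr0 /delta ?eqxx ?mulr1 // => j ji.
  by rewrite eq_sym (inj_eq val_inj) (negPf ji) mulr0.
have fsupp x : f x != 0 -> (x \in c) && ~~ odd_pos c x.
  apply: contraNT => nx; rewrite /f big1 // => i _; have := valP i.
  rewrite /delta; case: eqP => [<-|_ _]; last by rewrite mulr0.
  by rewrite inE (negPf nx).
have gsupp x : g x != 0 -> (x \in c) && odd_pos c x.
  by rewrite /g; case: ifP; rewrite ?eqxx.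
have combE : comb b (fun i x => delta C (val i) x -
    if (x \in c) && odd_pos c x then w (val i) x else 0) =1 (fun x => f x + g x).
  move=> x; rewrite /comb; under eq_bigr do rewrite mulrBr.
  rewrite sumrB -/(f x) /g; case: ifP => _; congr (_ + _); last first.
    by rewrite big1 ?oppr0 // => i _; rewrite mulr0.
  congr (- _); rewrite /f; under [RHS]eq_bigr do rewrite mulr_suml.
  rewrite exchange_big; apply: eq_bigr => i _ /=.
  under [RHS]eq_bigr do rewrite -mulrA mulrC -mulrA /delta.
  rewrite (bigD1 (val i)) //= big1 ?addr0; last first.
    by move=> u /negPf ->; rewrite mul0r.
  by rewrite eqxx mul1r mulrC.
have par0 (u v : G -> C) (b0 : bool) :
    (forall x, u x != 0 -> (x \in c) && (odd_pos c x == b0)) ->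
    (forall x, v x != 0 -> (x \in c) && (odd_pos c x == b0)) -> hform w u v = 0.
  move=> us vs; rewrite /hform big1 // => x _; rewrite big1 // => y _.
  have [->|/us/andP[xc /eqP xb]] := eqVneq (u x) 0; first by rewrite !mul0r.
  have [->|/vs/andP[yc /eqP yb]] := eqVneq (v y) 0; first by rewrite conjC0 mulr0.
  by rewrite [w x y](weight_same_parity phi Gd cc ec xc yc) ?xb ?yb // mulr0 mul0r.
have ff : hform w f f = 0 by apply: (par0 f f false) => x /fsupp; rewrite eqbF_neg.
have gg : hform w g g = 0 by apply: (par0 g g true) => x /gsupp; rewrite eqb_id.
have fg : hform w f g = - \sum_y `|g y| ^+ 2.
  rewrite /hform exchange_big -sumrN; apply: eq_bigr => y _ /=.
  rewrite -mulr_suml normCK; have [->|gy] := eqVneq (g y) 0.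
    by rewrite conjC0 !mulr0 oppr0.
  by rewrite -mulNr /g (gsupp _ gy) opprK.
have gf : hform w g f = - \sum_y `|g y| ^+ 2.
  rewrite -(hform_conj (weight_herm phi)) -/w fg rmorphN rmorph_sum; congr (- _).
  by apply: eq_bigr => y _; apply: conj_Creal; rewrite realX ?normr_real.
rewrite (eq_hform w combE combE) !hformDl !hformDr ff fg gf gg add0r addr0.
rewrite -opprD oppr_lt0 -mulr2n pmulrn_lgt0 //.
rewrite lt0r sumr_ge0 ?andbT => [|y _]; last by rewrite exprn_ge0.
apply: contra bi0 => s0; rewrite -fi; apply/eqP.
apply: (non_type_A_injective Gd cc ec nA fsupp) => y yc yo.
have := s0; rewrite psumr_eq0 => [/allP/(_ y)|z _]; last by rewrite exprn_ge0.
rewrite mem_index_enum expf_eq0 normr_eq0 /= /g yc yo oppr_eq0.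
by move/(_ isT)/eqP.
Qed.

Definition negative_half (S : {set G}) :=
  exists2 k, negative_on phi S k & #|S| = (2 * k)%N.

Lemma negative_half_peel (S : {set G}) mu h : pairing S mu -> h \in S ->
  (forall z, z \in S -> sedge h z -> z = mu h) ->
  pairing (S :\ h :\ mu h) mu /\
  (negative_half (S :\ h :\ mu h) -> negative_half S).
Proof.
move=> pS hS hz; have [mS mm e] := pS h hS.
have nh : mu h != h := pairing_neq pS hS.
split.
  move=> z; rewrite !inE => /and3P[zm zh zS]; have [mzS mmz ez] := pS z zS.
  split=> //; rewrite mzS andbT; apply/andP; split.
    by apply: contraNneq zh => E; rewrite -mmz E mm.
  by apply: contraNneq zm => E; rewrite -E mmz.
have SE : h |: (mu h |: (S :\ h :\ mu h)) = S.
  by rewrite setD1K ?setD1K // !inE nh.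
move=> [k nk ck]; exists k.+1.
  rewrite -SE; apply: negative_on_pendant => //; rewrite ?inE ?eqxx ?andbF //.
  move=> z; rewrite !inE => /and3P[zm zh zS]; apply: contra zm => hz'.
  by apply/eqP; apply: hz.
rewrite (cardsD1 h S) hS (cardsD1 (mu h) (S :\ h)) !inE nh mS ck /=; lia.
Qed.

Lemma negative_half0 : negative_half set0.
Proof. by exists 0%N; [exact: negative_on_set0 | rewrite cards0]. Qed.

(** By [alternating_path] started at a vertex whose mate is off the cycle, there is
   always a pendant vertex to split off. *)
Lemma negative_half_open (S : {set G}) mu : pairing S mu ->
  (forall c1 c2 : seq G, is_cycle c1 -> is_cycle c2 ->
     {subset c1 <= S} -> {subset c2 <= S} -> c1 =i c2) ->
  (forall c : seq G, is_cycle c -> {subset c <= S} ->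
     exists2 x, x \in c & mu x \notin c) ->
  negative_half S.
Proof.
have [n] := ubnP #|S|; elim: n S => // n IHn S ltS pS one open.
have [->|[x0 x0S]] := set_0Vmem S; first exact: negative_half0.
have [h hS hz] : exists2 h, h \in S & forall z, z \in S -> sedge h z -> z = mu h.
  have [[c [cc cS _]]|[h [hS _ hz _]]] := alternating_path pS x0S; last by exists h.
  have [x xc mx] := open c cc cS.
  have [[c' [cc' cS' cl]]|[h [hS _ hz _]]] := alternating_path pS (cS x xc); last by exists h.
  have E := one c c' cc cc' cS cS'.
  by case/negP: mx; rewrite E; apply: cl; rewrite -E.
have [pS' peel] := negative_half_peel pS hS hz.
have sub : {subset S :\ h :\ mu h <= S} by move=> z; rewrite !inE => /and3P[].
apply: peel; apply: IHn => //.
- move: ltS; rewrite (cardsD1 h S) hS; have := subset_leq_card (subD1set (S :\ h) (mu h)); lia.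
- by move=> c1 c2 cc1 cc2 s1 s2; apply: one => // z => [/s1|/s2]; apply: sub.
- by move=> c cc cS; apply: open => // z /cS; apply: sub.
Qed.

Lemma negative_half_acyclic (S : {set G}) mu : pairing S mu ->
  (forall c : seq G, is_cycle c -> ~ {subset c <= S}) -> negative_half S.
Proof.
move=> pS noC; apply: (negative_half_open pS) => [c1 c2 cc1 _ s1|c cc s1].
  by case: (noC c1).
by case: (noC c).
Qed.

(** Pendant vertices outside the cycle are split off until only the cycle remains.
   To find one, an alternating path outside the cycle is started at a vertex
   attached to the cycle: if its other end were attached as well, the path would
   lie on a second cycle meeting the first. *)
Lemma negative_half_non_type_A (S : {set G}) mu (c : seq G) :
  cycles_disjoint G -> pairing S mu -> is_cycle c -> {subset c <= S} ->
  (forall x, x \in c -> mu x \in c) ->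
  (forall c' : seq G, is_cycle c' -> {subset c' <= S} -> c' =i c) ->
  ~~ odd (size c) -> ~ type_A phi c -> negative_half S.
Proof.
move=> Gd + cc; have [n] := ubnP #|S|; elim: n S => // n IHn S ltS pS cS cl one ec nA.
pose S2 := S :\: [set x in c].
have pS2 : pairing S2 mu.
  move=> x; rewrite !inE => /andP[xc xS]; have [mS mm e] := pS x xS.
  by split=> //; rewrite mS andbT; apply: contra xc => /cl; rewrite mm.
have [S20|[x1 x1S2]] := set_0Vmem S2.
  have -> : S = [set x in c].
    apply/eqP; rewrite eqEsubset -setD_eq0 -/S2 S20 eqxx /=.
    by apply/subsetP => x; rewrite inE => /cS.
  exists (size c)./2; first exact: negative_on_non_type_A.
  by rewrite (card_cycle_set cc) mul2n -[LHS]odd_double_half (negPf ec).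
pose att x := (x \in S2) && [exists v, (v \in c) && sedge x v].
have [x0 x0S2 x0P] : exists2 x0, x0 \in S2 &
    forall x, att x -> exists2 v, v \in c & sedge x0 v.
  case: (pickP att) => [x0 /andP[x0S2 /existsP[v /andP[vc xv]]]|none].
    by exists x0 => // x _; exists v.
  by exists x1 => // x; rewrite none.
have notS2 x : x \in c -> x \notin S2 by rewrite !inE => ->.
have [h [hS2 hz]] : exists h, h \in S2 /\ forall z, z \in S -> sedge h z -> z = mu h.
  have [[c' [cc' cS2 _]]|[h [hS2 hx0 hz con]]] := alternating_path pS2 x0S2.
    have sub : {subset c' <= S} by move=> x /cS2; rewrite !inE => /andP[].
    have E := one c' cc' sub; have [x xc] : exists x, x \in c'.
      by have := size_cycle_gt0 cc'; case: (c') => // x s _; exists x; rewrite mem_head.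
    by have := cS2 x xc; rewrite !inE -E xc.
  exists h; split=> // z zS hzE.
  have [zc|zc] := boolP (z \in c); last by apply: hz; rewrite // !inE zc.
  have [|v vc x0v] := x0P h.
    by rewrite /att hS2; apply/existsP; exists z; rewrite zc.
  have vS2 := notS2 v vc.
  have conn : connect (@sedge (del_edge x0 v)) v x0.
    apply: (@connect_trans _ _ z).
      have ccd : is_cycle (G := del_edge x0 v) c.
        rewrite is_cycle_del_edge cc /=; apply/negP => /cycle_edges_mem/andP[x0c _].
        by rewrite (negPf (notS2 _ x0c)) in x0S2.
      by case/and3P: ccd => _ _ /connect_cycle; apply.
    apply: (@connect_trans _ _ h).
      apply: connect1; rewrite /sedge /= /del_edge_rel sedge_sym hzE /=.
      apply/eqP => /(@set2_inj G)[] [zx hv]; last by rewrite hv eqxx in hx0.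
      by have := notS2 z zc; rewrite zx x0S2.
    rewrite (@sconnect_sym (del_edge x0 v)).
    move: con; apply: connect_sub => u u' /= /and3P[uS2 u'S2 uu'].
    apply: connect1; rewrite /sedge /= /del_edge_rel uu' /=.
    apply/eqP => /(@set2_inj G)[] [ux u'v]; first by rewrite u'v (negPf vS2) in u'S2.
    by rewrite ux (negPf vS2) in uS2.
  have [c' [cc' x0c' nv]] := nonbridge_on_cycle x0v conn.
  have vc' : v \in c' by rewrite -nv mem_next.
  have E := eq_mem_of_meet Gd cc' cc vc' vc.
  by have := notS2 x0; rewrite -E x0c' x0S2 => /(_ isT).
have hS : h \in S by move: hS2; rewrite inE => /andP[].
have hc : h \notin c by move: hS2; rewrite !inE => /andP[].
have mhc : mu h \notin c.
  by apply: contra hc => /cl; have [_ -> _] := pS h hS.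
have [pS' peel] := negative_half_peel pS hS hz.
have sub : {subset S :\ h :\ mu h <= S} by move=> z; rewrite !inE => /and3P[].
apply: peel; apply: IHn => //.
- move: ltS; rewrite (cardsD1 h S) hS; have := subset_leq_card (subD1set (S :\ h) (mu h)); lia.
- move=> z zc; rewrite !inE (cS z zc) andbT; apply/andP; split.
    by apply: contraNneq mhc => <-.
  by apply: contraNneq hc => <-.
- by move=> c' cc' cS'; apply: one => // z /cS'; apply: sub.
Qed.

Lemma negative_half_leq S : negative_half S -> (#|S| <= 2 * negative_inertia phi)%N.
Proof. by move=> [k /negative_on_leq lek ->]; rewrite leq_mul2l. Qed.

End LowerBounds.

(** * An isotropic family *)

Section UpperBound.
Variables (C : numClosedFieldType) (G : sgraph) (phi : unit_gain C G).
Let w := weight phi.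
Let O := cycle_vertices G.
Let V := cycle_vsets G.

(** Off [X] only the cycles have edges.  The family consists of the isolated
   vertices, the even positions of the cycles, and for every cycle one null vector
   on its odd positions. *)
Lemma inertia_upper (X : {set G}) : cycles_disjoint G ->
  (forall c : seq G, is_cycle c -> type_A phi c) ->
  X \subset ~: O ->
  (forall x y, sedge x y -> x \notin X -> y \notin X ->
     (x \in O) && (y \in cycle_through x)) ->
  (2 * negative_inertia phi + 2 * #|V| <= 2 * #|X| + #|O|)%N.
Proof.
move=> Gd tA XO cov.
have even (c : seq G) : is_cycle c -> ~~ odd (size c) by move=> cc; have [] := tA c cc.
pose thr := @cycle_through G.
have nX x : x \in O -> x \notin X.
  by move=> xO; apply/negP => /(subsetP XO); rewrite in_setC xO.
pose D := [set x in O | ~~ odd_pos (thr x) x] :|: (~: O :\: X).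
have DX x : x \in D -> x \notin X.
  rewrite in_setU in_setD => /orP[|/andP[]//].
  by rewrite in_set => /andP[/nX].
have Deven x : x \in D -> x \in O -> ~~ odd_pos (thr x) x.
  move=> + xO; rewrite in_setU in_setD in_setC xO andbF orbF.
  by rewrite in_set => /andP[].
have [z zP] : exists z : {set G} -> G -> C, forall B, B \in V ->
    (forall x, (z B x != 0) = (x \in B) && odd_pos (thr x) x) /\
    (forall y, y \in B -> ~~ odd_pos (thr y) y -> \sum_x z B x * w x y = 0).
  have zB B : exists zB : G -> C, B \in V ->
    (forall x, (zB x != 0) = (x \in B) && odd_pos (thr x) x) /\
    (forall y, y \in B -> ~~ odd_pos (thr y) y -> \sum_x zB x * w x y = 0).
    have [BV|] := boolP (B \in V); last by exists (fun _ => 0).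
    have [c0 cc0 EB] := cycle_vsetsP _ BV.
    have [x0 x0c] : exists x, x \in c0 by exact: cycle_inhabited.
    have xO := mem_cycle_vertices cc0 x0c.
    have cc := is_cycle_through xO.
    have EBc x : (x \in B) = (x \in thr x0).
      by rewrite -EB inE; apply: (eq_mem_of_meet Gd cc0 cc x0c); apply: mem_cycle_through.
    have Et x : x \in B -> thr x = thr x0.
      by rewrite EBc; apply: eq_cycle_through.
    have [zz [z1 z2]] := type_A_null_vector Gd cc (even _ cc) (tA _ cc).
    exists zz => _; split=> [x|y yB].
      by rewrite z1 -/(thr x0) EBc; case xB: (x \in thr x0); rewrite //= Et ?EBc.
    by rewrite Et //; apply: z2; rewrite -EBc.
  exact: fin_all_exists zB.
have zthr B x : B \in V -> x \in B -> (x \in O) /\ forall y, (y \in B) = (y \in thr x).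
  move=> BV xB; have xO : x \in O by apply/bigcupP; exists B.
  split=> // y; have [_ E] := cycle_throughP xO.
  by rewrite -(def_pblock (trivIset_cycle_vsets Gd) BV xB) -E inE.
pose I : finType := ({x | x \in D} + {B | B \in V})%type.
pose F (j : I) : G -> C :=
  match j with inl x => delta C (val x) | inr B => z (val B) end.
have znX B x : B \in V -> z B x != 0 -> [/\ x \in B, x \in O & odd_pos (thr x) x].
  move=> BV; have [-> _] := zP B BV; move=> /andP[xB xo].
  by have [xO _] := zthr B x BV xB.
have wE x y : w x y != 0 -> sedge x y by apply: contraNT => nxy; rewrite /w weight0.
have wsame x y : x \notin X -> y \notin X ->
    (x \in O -> y \in thr x -> odd_pos (thr x) x = odd_pos (thr y) y) -> w x y = 0.
  move=> xX yX par; apply/eqP/negPn/negP => /wE xy.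
  have /andP[xO yx] := cov x y xy xX yX.
  have cc := is_cycle_through xO; have xc := mem_cycle_through xO.
  have := par xO yx; rewrite /thr (eq_cycle_through Gd xO yx) => E.
  have := weight_same_parity phi Gd cc (even _ cc) xc yx E.
  by move/eqP; rewrite (negPf (weight_neq0 phi xy)).
have dz x B : x \in D -> B \in V -> hform w (z B) (delta C x) = 0.
  move=> xD BV; rewrite hform_deltar.
  have [xB|xB] := boolP (x \in B).
    have [xO _] := zthr B x BV xB.
    by have [_ z0] := zP B BV; apply: z0 => //; apply: Deven.
  rewrite big1 // => u _; have [->|zu] := eqVneq (z B u) 0; first by rewrite mul0r.
  have [uB uO uo] := znX B u BV zu; rewrite wsame ?mulr0 //; [exact: nX|exact: DX|].
  move=> _ xu.
  by have [_ E] := zthr B u BV uB; rewrite E xu in xB.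
have iso : totally_isotropic w F.
  move=> [[x xD]|[B BV]] [[y yD]|[B' BV']] /=.
  - rewrite hform_delta wsame ?DX // => xO yx.
    have yO := mem_cycle_throughO xO yx.
    by rewrite (negPf (Deven x xD xO)) (negPf (Deven y yD yO)).
  - by rewrite -(hform_conj (weight_herm phi)) -/w dz ?rmorph0.
  - exact: dz.
  - rewrite /hform big1 // => u _; rewrite big1 // => v _.
    have [->|zu] := eqVneq (z B u) 0; first by rewrite !mul0r.
    have [->|zv] := eqVneq (z B' v) 0; first by rewrite conjC0 mulr0.
    have [uB uO uo] := znX B u BV zu; have [vB vO vo] := znX B' v BV' zv.
    by rewrite wsame ?mulr0 ?mul0r ?nX // => _ _; rewrite uo vo.
have ind : independent F.
  move=> b b0 j.
  have combE x : comb b F x = \sum_(i : {x | x \in D}) b (inl i) * delta C (val i) x +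
      \sum_(B : {B | B \in V}) b (inr B) * z (val B) x.
    by rewrite /comb big_sumType.
  case: j => [i|B].
    have xD := valP i; have := b0 (val i); rewrite combE.
    rewrite (bigD1 i) //= [X in _ * _ + X + _]big1 => [|k ki]; last first.
      by rewrite /delta (inj_eq val_inj) eq_sym (negPf ki) mulr0.
    rewrite big1 => [|B _]; last first.
      have [->|zx] := eqVneq (z (val B) (val i)) 0; first by rewrite mulr0.
      have [_ xO xo] := znX _ _ (valP B) zx.
      by have := Deven _ xD xO; rewrite xo.
    by rewrite /delta eqxx mulr1 !addr0.
  have BV := valP B; have [x xB xo] : exists2 x, x \in val B & odd_pos (thr x) x.
    have [c cc EB] := cycle_vsetsP _ BV.
    have [x xc] : exists x, x \in c by exact: cycle_inhabited.
    have xB : x \in val B by rewrite -EB inE.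
    have [xO E] := zthr _ _ BV xB.
    have cct := is_cycle_through xO; have xt := mem_cycle_through xO.
    have [xo|xe] := boolP (odd_pos (thr x) x); first by exists x.
    have nt : next (thr x) x \in thr x by rewrite mem_next.
    exists (next (thr x) x); first by rewrite E.
    by rewrite {1}/thr (eq_cycle_through Gd xO nt) odd_pos_next ?even.
  have [xO E] := zthr _ _ BV xB.
  have zx : z (val B) x != 0 by have [-> _] := zP _ BV; rewrite xB xo.
  have := b0 x; rewrite combE big1 => [|i _]; last first.
    rewrite /delta; case: eqP => [xi|_]; last by rewrite mulr0.
    by have := Deven _ (valP i); rewrite -xi xO xo => /(_ isT).
  rewrite add0r (bigD1 B) //= big1 ?addr0 => [/eqP|B' B'B].
    by rewrite mulf_eq0 (negPf zx) orbF => /eqP.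
  have [->|zx'] := eqVneq (z (val B') x) 0; first by rewrite mulr0.
  have [xB' _ _] := znX _ _ (valP B') zx'.
  case/negP: B'B; rewrite -(inj_eq val_inj) /=.
  rewrite -(def_pblock (trivIset_cycle_vsets Gd) BV xB).
  by rewrite -(def_pblock (trivIset_cycle_vsets Gd) (valP B') xB').
have := totally_isotropic_leq (weight_herm phi) iso ind.
rewrite card_sum !card_sig -/(negative_inertia phi).
have -> : #|[pred x | x \in D]| = #|D| by apply: eq_card.
have -> : #|[pred B | B \in V]| = #|V| by apply: eq_card.
have cD : #|D| = (#|[set x in O | ~~ odd_pos (thr x) x]| + #|~: O :\: X|)%N.
  rewrite cardsU; suff -> : [set x in O | ~~ odd_pos (thr x) x] :&: (~: O :\: X) = set0.
    by rewrite cards0 subn0.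
  apply/setP => x; rewrite in_setI in_set0 in_setD in_setC in_set.
  by case: (x \in O); rewrite ?andbF.
have cO : (2 * #|[set x in O | ~~ odd_pos (thr x) x]| = #|O|)%N.
  exact: even_through_card.
have cX : #|~: O :\: X| = (#|~: O| - #|X|)%N by rewrite cardsD (setIidPr XO).
have := cardsC O; have := subset_leq_card XO.
rewrite -/(negative_inertia phi); move: (negative_inertia phi) cD cO cX.
lia.
Qed.

End UpperBound.

(** * Extremal gain graphs *)

Section ExtremalGraphs.
Variables (C : numClosedFieldType) (G : sgraph) (phi : unit_gain C G).
Hypothesis Gc : connected_graph G.
Let O := cycle_vertices G.
Let V := cycle_vsets G.
Let T := contract_cycles G.

Lemma inertia_lower :
  (matching_number G)%:Z <= (negative_inertia phi)%:Z + cyclomatic G.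
Proof.
have [U leU tU] := cycle_transversal Gc.
have [S [mu [pS cS]]] := matching_number_pairing G.
have [pS' leS] := pairing_avoid U pS.
have noC (c : seq G) : is_cycle c -> {subset c <= avoiding S U mu} -> False.
  by move=> cc cS'; have [x xc xU] := tU c cc; have := avoiding_notin (cS' x xc); rewrite xU.
have nS' : negative_half phi (avoiding S U mu).
  exact: negative_half_acyclic pS' noC.
have := negative_half_leq nS'; move: leS; rewrite cS.
by move: #|avoiding S U mu| leU; lia.
Qed.

Section Extremal.
Hypothesis ext : (negative_inertia phi)%:Z = (matching_number G)%:Z - cyclomatic G.
Variables (S : {set G}) (mu : G -> G).
Hypotheses (pS : pairing S mu) (cS : #|S| = (2 * matching_number G)%N).

(** Each vertex saved below the cyclomatic number raises the lower bound for the
   inertia. *)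
Lemma extremal_avoiding (U : {set G}) :
  #|U|%:Z + 1 <= cyclomatic G -> ~ negative_half phi (avoiding S U mu).
Proof.
move=> leU /negative_half_leq; have [_] := pairing_avoid U pS.
rewrite cS.
by move: #|avoiding S U mu| ext leU; lia.
Qed.

Lemma extremal_cycles_disjoint : cycles_disjoint G.
Proof.
apply: (cycles_disjoint_of_transversals Gc) => U leU.
have [/existsP[B /andP[/cycle_vsetsP[c cc EB] dB]]|none] :=
    boolP [exists B : {set G}, (B \in V) && [disjoint B & U]].
  exists c => // x xc; move: dB; rewrite disjoint_subset => /subsetP/(_ x).
  by rewrite -EB !inE; apply.
case: (extremal_avoiding leU).
have noC (c : seq G) : is_cycle c -> {subset c <= avoiding S U mu} -> False.
  move=> cc cS'; case/existsP: none; exists [set x in c]; apply/andP; split.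
    by apply/cycle_vsetsP; exists c.
  rewrite disjoint_subset; apply/subsetP => x; rewrite inE => xc.
  by rewrite inE; apply: (avoiding_notin (cS' x xc)).
have [pS' _] := pairing_avoid U pS.
exact: negative_half_acyclic pS' noC.
Qed.

Let Gd := extremal_cycles_disjoint.

Lemma transversal_off (c : seq G) : is_cycle c ->
  exists2 U : {set G}, #|U|%:Z + 1 <= cyclomatic G &
    forall c' : seq G, is_cycle c' -> {subset c' <= avoiding S U mu} -> c' =i c.
Proof.
move=> cc; have [a ac] : exists x, x \in c by exact: cycle_inhabited.
have [U leU tU] := cycle_transversal_but_one Gc cc ac; exists U => // c' cc' sub.
have [/cycle_edges_mem/andP[ac' _]|nin] := boolP ([set a; next c a] \in cycle_edges c').
  exact: (eq_mem_of_meet Gd cc' cc ac' ac).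
by have [x /sub /avoiding_notin/negPf -> //] := tU c' cc' nin.
Qed.

(** Otherwise, after deleting fewer vertices than the cyclomatic number, no cycle
   is left on which the matching is perfect. *)
Lemma extremal_cycle_matched (c : seq G) : is_cycle c ->
  forall x, x \in c -> (x \in S) && (mu x \in c).
Proof.
move=> cc x xc; apply/negPn/negP => bad.
have [U leU uniqU] := transversal_off cc.
apply: (extremal_avoiding leU); have [pS' _] := pairing_avoid U pS.
apply: (negative_half_open _ pS') => [c1 c2 cc1 cc2 s1 s2|c' cc' s'] .
  by move=> y; rewrite (uniqU c1 cc1 s1) (uniqU c2 cc2 s2).
have E := uniqU c' cc' s'; exists x; first by rewrite E.
by rewrite E; apply: contra bad => ->; rewrite (avoiding_sub (s' x _)) ?E.
Qed.

Lemma extremal_even (c : seq G) : is_cycle c -> ~~ odd (size c).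
Proof.
move=> cc; rewrite -(card_cycle_set cc).
apply: (@pairing_even _ _ mu) => x; rewrite !inE => xc.
have /andP[xS mc] := extremal_cycle_matched cc xc; have [_ mm e] := pS xS.
by rewrite mc mm.
Qed.

Lemma extremal_type_A (c : seq G) : is_cycle c -> type_A phi c.
Proof.
move=> cc; have ec := extremal_even cc; split=> //; apply/eqP/negPn/negP => nA.
have ntA : ~ type_A phi c by case=> _ /eqP E; rewrite E in nA.
have [U leU uniqU] := transversal_off cc.
apply: (extremal_avoiding leU); have [pS' _] := pairing_avoid U pS.
have closed x : x \in c -> mu x \in c by move/(extremal_cycle_matched cc)/andP => [].
have [/allP cU|/allPn[y yc yU]] := boolP (all (fun x => x \notin U) c).
  apply: (@negative_half_non_type_A _ _ phi _ mu c) => //.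
  move=> x xc; have /andP[xS mc] := extremal_cycle_matched cc xc.
  by rewrite inE xS cU // cU.
have noC (c' : seq G) : is_cycle c' -> {subset c' <= avoiding S U mu} -> False.
  move=> cc' s'; have E := uniqU c' cc' s'.
  have := s' y; rewrite E => /(_ yc)/avoiding_notin.
  by rewrite (negPf yU).
exact: negative_half_acyclic pS' noC.
Qed.

(** A maximum matching is perfect on every cycle, so its other edges avoid the cycles. *)
Lemma extremal_matching_outside :
  (2 * matching_number G <= 2 * matching_number (induced (~: O)) + #|O|)%N.
Proof.
have inS x : x \in O -> (x \in S) && (mu x \in O).
  move=> xO; have cc := is_cycle_through xO; have xc := mem_cycle_through xO.
  have /andP[-> mc] := extremal_cycle_matched cc xc.
  exact: mem_cycle_throughO mc.
have pSO : pairing (S :\: O) mu.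
  move=> x; rewrite !in_setD => /andP[xO xS]; have [mS mm e] := pS xS.
  by rewrite mS mm andbT; split=> //; apply: contra xO => /inS; rewrite mm => /andP[].
rewrite -cS -(cardsID O S) addnC leq_add //.
  by apply: (induced_pairing_leq pSO); apply/subsetP => x; rewrite in_setD in_setC => /andP[].
by apply/subset_leq_card/subsetIr.
Qed.

(** A maximum matching of the contraction lifts to a matched set that the lower bound
   for the inertia compares with a maximum matching of the graph. *)
Lemma extremal_contraction :
  matching_number T = matching_number (induced (~: O)).
Proof.
apply/eqP; rewrite eqn_leq (konig_leq Gd) andbT.
have [S1 [mu1 [pS1 noC leS1]]] := lift_matching Gd extremal_even.
have nS1 : negative_half phi S1.
  apply: (negative_half_acyclic _ pS1) => c cc s1.
  by have [x xc] := noC c cc; rewrite s1.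
have := negative_half_leq nS1; have := extremal_matching_outside.
have := card_cycle_vsets Gc Gd; move: ext leS1; rewrite -/V -/O -/T.
move: #|V| #|O| #|S1| (matching_number T) (matching_number (induced (~: O))).
lia.
Qed.

End Extremal.

Lemma extremal_of_conditions : cycles_disjoint G ->
  (forall c : seq G, is_cycle c -> type_A phi c) ->
  matching_number T = matching_number (induced (~: O)) ->
  (negative_inertia phi)%:Z = (matching_number G)%:Z - cyclomatic G.
Proof.
move=> Gd tA mE.
have even (c : seq G) : is_cycle c -> ~~ odd (size c) by move=> cc; have [] := tA c cc.
have [X [XO leX cov]] := konig_cover_off_cycles Gd mE.
have := inertia_upper Gd tA XO cov; have := matching_number_outside Gd even.
have := card_cycle_vsets Gc Gd; have := inertia_lower.
move: leX; rewrite mE -/V -/O.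
move: #|V| #|O| #|X| (matching_number (induced (~: O))).
lia.
Qed.

End ExtremalGraphs.

Theorem theorem3p10 (R : realType) (G : sgraph) (phi : unit_gain R[i] G)
    (Gconn : connected_graph G) :
  (negative_inertia phi)%:Z = (matching_number G)%:Z - cyclomatic G
  <->
  [/\ cycles_disjoint G,
      forall c : seq G, is_cycle c -> type_A phi c &
      matching_number (contract_cycles G) =
        matching_number (induced (~: cycle_vertices G))].
Proof.
split=> [ext|[Gd tA mE]]; last exact: (extremal_of_conditions Gconn).
have [S [mu [pS cS]]] := matching_number_pairing G.
split.
- exact: (extremal_cycles_disjoint Gconn ext pS cS).
- exact: (extremal_type_A Gconn ext pS cS).
- exact: (extremal_contraction Gconn ext pS cS).
Qed.
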